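(* Let $\mathfrak{A}$ be a $C^*$-algebra, let $T$ be a locally compact Hausdorff space equipped with a Radon measure $\mu$, and let $(A_t)_{t\in T}$ and $(B_t)_{t\in T}$ be continuous fields of operators in $\mathfrak{A}$ such that the functions $t\mapsto A_t$ and $t\mapsto B_t$ are norm continuous on $T$ and the functions $t\mapsto\|A_t\|$ and $t\mapsto\|B_t\|$ are integrable. Let $\alpha:T\times T\to\mathbb{C}$ be a measurable function such that $\overline{\alpha(t,s)}\,\alpha(s,t)=1$ for all $t,s\in T$. Then $$\left|\int_T(A_t-B_t)\,d\mu(t)\right|^2\le\int_T\int_T\left|\alpha(t,s)A_t-\alpha(s,t)B_s\right|^2d\mu(t)d\mu(s).$$
   Context: For an element $X$ of a $C^*$-algebra, $|X|=(X^*X)^{1/2}$, so $|X|^2=X^*X$. The inequality $\le$ is the usual order on self-adjoint elements of $\mathfrak{A}$ ($X\le Y$ iff $Y-X$ is positive). A field $(A_t)_{t\in T}$ of operators in $\mathfrak{A}$ is called continuous if $t\mapsto A_t$ is norm continuous on $T$. If moreover $t\mapsto\|A_t\|$ is integrable with respect to $\mu$, then $\int_T A_t\,d\mu(t)$ denotes the Bochner integral, i.e. the unique element of $\mathfrak{A}$ with $\varphi\left(\int_T A_t\,d\mu(t)\right)=\int_T\varphi(A_t)\,d\mu(t)$ for every $\varphi$ in the norm dual $\mathfrak{A}^*$ of $\mathfrak{A}$.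
   Formalization: The existence of the iterated Bochner integral on the right-hand side is assumed (inner integrand Bochner integrable for almost every s, and the inner integral integrable in s), as the stated hypotheses do not ensure it (e.g. T the real line with Lebesgue measure, α = 1). *)

(* Defs.v *)
From HB Require Import structures.
From mathcomp Require Import all_boot all_order all_algebra.
From mathcomp Require Import complex.
From mathcomp Require Import all_classical all_reals all_analysis.
Import Order.TTheory GRing.Theory Num.Theory.
Import numFieldNormedType.Exports.

Set Implicit Arguments.
Unset Strict Implicit.
Unset Printing Implicit Defensive.

Local Open Scope classical_set_scope.
Local Open Scope ring_scope.

(* A C*-algebra need not have a unit, so its product cannot be the ring product
   of the (unital) ring hierarchy.  The norm takes values in R[i]. *)
HB.mixin Record isCStarAlgebra (R : realType) A
    & CompleteNormedModule R[i] A := {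
  cmul : A -> A -> A ;
  star : A -> A ;
  cmulA : associative cmul ;
  cmulDl : left_distributive cmul +%R ;
  cmulDr : right_distributive cmul +%R ;
  cscalerAl : forall (a : R[i]) (x y : A), a *: cmul x y = cmul (a *: x) y ;
  cscalerAr : forall (a : R[i]) (x y : A), a *: cmul x y = cmul x (a *: y) ;
  cnormM : forall x y : A, `|cmul x y| <= `|x| * `|y| ;
  starK : involutive star ;
  starD : {morph star : x y / x + y} ;
  starZ : forall (a : R[i]) (x : A), star (a *: x) = conjc a *: star x ;
  starM : forall x y : A, star (cmul x y) = cmul (star y) (star x) ;
  cstar_id : forall x : A, `|cmul (star x) x| = `|x| ^+ 2
}.

#[short(type="cstarAlgType")]
HB.structure Definition CStarAlgebra (R : realType) :=
  {A of isCStarAlgebra R A & CompleteNormedModule R[i] A}.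

Section CStarTheory.
Context {R : realType} {A : cstarAlgType R}.
Implicit Types x y : A.

Definition rnorm x : R := complex.Re `|x|.

(* |x|^2, where |x| is the positive square root of x^* x *)
Definition sqabs x : A := cmul (star x) x.

(* (x, a) stands for x + a 1 in the unitization of A *)
Definition unitization_mul (u v : A * R[i]) : A * R[i] :=
  (cmul u.1 v.1 + u.2 *: v.1 + v.2 *: u.1, u.2 * v.2).

(* Spectrum in the unitization; if A is already unital, this is the spectrum in
   A with 0 added to it. *)
Definition spectrum x : set R[i] :=
  [set l | ~ exists v, unitization_mul (- x, l) v = (0, 1) /\
                       unitization_mul v (- x, l) = (0, 1)].

(* In R[i], 0 <= l means that l is a nonnegative real number. *)
Definition cpositive x : Prop :=
  star x = x /\ forall l, spectrum x l -> 0 <= l.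

Definition cle x y : Prop := cpositive (y - x).

End CStarTheory.

Section BochnerIntegral.
Context {R : realType} {A : cstarAlgType R}.
Context {d : measure_display} {T : measurableType d}.
Variable mu : {measure set T -> \bar R}.
Implicit Types (f g : T -> A) (I : A).

Definition simple_fun f : Prop :=
  finite_set (range f) /\ forall x, measurable (f @^-1` [set x]).

Definition strongly_measurable f : Prop :=
  exists2 s : nat -> T -> A,
    forall n, simple_fun (s n) & forall t, s n t @[n --> \oo] --> f t.

Definition norm_integrable f : Prop :=
  mu.-integrable setT (fun t => (rnorm (f t))%:E).

Definition cintegral (h : T -> R[i]) : R[i] :=
  Complex (Rintegral mu setT (fun t => complex.Re (h t)))
          (Rintegral mu setT (fun t => complex.Im (h t))).

(* mu is not assumed to be complete, and a continuous field on a nonseparable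
   space is a limit of simple functions only almost everywhere: f is therefore
   replaced by an almost everywhere equal version g. *)
Definition is_bochner f I : Prop :=
  exists g, [/\ strongly_measurable g,
                {ae mu, forall t, f t = g t},
                norm_integrable g &
                forall phi : {linear A -> R[i]^o}, continuous phi ->
                  phi I = cintegral (fun t => phi (g t))].

Definition bochner_integrable f : Prop := exists I, is_bochner f I.

(* The value is 0 if f is not Bochner integrable. *)
Definition bochner f : A := xget 0 [set I | is_bochner f I].

End BochnerIntegral.

Notation borel T := (g_sigma_algebraType (@open T)).

(* Borel measures that are finite on compact sets, outer regular on Borel sets
   and inner regular on open sets *)
Definition radon {R : realType} {T : ptopologicalType}
    (mu : {measure set (borel T) -> \bar R}) : Prop :=
  [/\ forall K : set T, compact K -> (mu K < +oo)%E,
      forall E : set T, measurable (E : set (borel T)) ->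
        mu E = ereal_inf [set mu U | U in [set U : set T | open U /\ E `<=` U]] &
      forall U : set T, open U ->
        mu U = ereal_sup [set mu K | K in [set K : set T | compact K /\ K `<=` U]]].

(* Main.v *)
Require Import Defs.
From HB Require Import structures.
From mathcomp Require Import all_boot all_order all_algebra.
From mathcomp Require Import complex.
From mathcomp Require Import all_classical all_reals all_analysis.
From mathcomp Require Import finmap measurable_realfun ring lra.
Import Order.TTheory GRing.Theory Num.Theory.
Import numFieldNormedType.Exports.

Set Implicit Arguments.
Unset Strict Implicit.
Unset Printing Implicit Defensive.

Local Open Scope classical_set_scope.
Local Open Scope ring_scope.
(* Write F(t,s) for the integrand and D = A - B.  As conj(alpha(t,s)) alpha(s,t)
   = 1, expanding the squares gives
     F(t,s) + F(s,t) - D_s^* D_t - D_t^* D_s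
       = |alpha(t,s) A_t - alpha(s,t) A_s|^2 + |alpha(t,s) B_t - alpha(s,t) B_s|^2
       >= 0.
   Integrating a positive functional f of this over T x T yields the inequality,
   since the two halves of F contribute equally by Tonelli's theorem, and each of
   the D terms integrates to f(|int D|^2).  Tonelli's theorem needs sigma-finiteness
   and product measurability: by inner regularity D vanishes almost everywhere
   outside a sigma-compact set W of sigma-finite measure, and continuous functions
   on W x W are measurable for the product of the Borel sigma-algebras.
   That positivity can be tested on functionals is Hahn-Banach for the closed cone
   of positive elements; that x^* x lies in this cone (Kaplansky) is derived without
   spectral theory, from the square root of 1 - c for self-adjoint c of norm at
   most 1. *)

(** * The unitization as a C*-algebra *)

Section ComplexModulus.
Context {R : realType}.
Implicit Types a b : R[i].

Definition cabs a : R := complex.Re `|a|.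

Lemma cabsE a : `|a| = (cabs a)%:C%C.
Proof. by rewrite /cabs normc_def. Qed.

Lemma cabs_ge0 a : 0 <= cabs a.
Proof. by have := normr_ge0 a; rewrite cabsE ler0c. Qed.

Lemma cabs_eq0 a : cabs a = 0 -> a = 0.
Proof. by move=> a0; apply/eqP; rewrite -normr_eq0 cabsE a0. Qed.

Lemma cabsD a b : cabs (a + b) <= cabs a + cabs b.
Proof. by have := ler_normD a b; rewrite !cabsE -rmorphD lecR. Qed.

Lemma cabsM a b : cabs (a * b) = cabs a * cabs b.
Proof. by apply: complexI; rewrite rmorphM /= -!cabsE normrM. Qed.

Lemma cabsN a : cabs (- a) = cabs a.
Proof. by rewrite /cabs normrN. Qed.

Lemma cabsJ a : cabs (conjc a) = cabs a.
Proof. by rewrite /cabs normcJ. Qed.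

Lemma cabs_real (r : R) : cabs r%:C%C = `|r|.
Proof. by rewrite /cabs normc_def /= expr0n addr0 sqrtr_sqr. Qed.

Lemma cabs_i : cabs 'i%C = 1.
Proof. by rewrite /cabs normc_def /= expr0n add0r expr1n sqrtr1. Qed.

Lemma Re_le_cabs a : `|complex.Re a| <= cabs a.
Proof. by have := normc_ge_Re a; rewrite cabsE lecR. Qed.

Lemma Im_le_cabs a : `|complex.Im a| <= cabs a.
Proof.
by rewrite -normrN -ReiNIm (le_trans (Re_le_cabs _))// cabsM cabs_i mulr1.
Qed.

Lemma cabs_le a : cabs a <= `|complex.Re a| + `|complex.Im a|.
Proof.
rewrite [X in cabs X]complexE (le_trans (cabsD _ _))// cabsM cabs_i mul1r.
by rewrite !cabs_real.
Qed.

End ComplexModulus.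

Section RealNorm.
Context {R : realType} {A : cstarAlgType R}.
Implicit Types x y : A.

Lemma rnormE x : `|x| = (rnorm x)%:C%C.
Proof.
by have := ger0_Im (normr_ge0 x); rewrite /rnorm; case: `|x| => a b /= ->.
Qed.

Lemma rnorm_ge0 x : 0 <= rnorm x.
Proof. by have := normr_ge0 x; rewrite rnormE ler0c. Qed.

Lemma rnorm_eq0 x : rnorm x = 0 -> x = 0.
Proof. by move=> x0; apply/eqP; rewrite -normr_eq0 rnormE x0. Qed.

Lemma rnorm0 : rnorm (0 : A) = 0.
Proof. by rewrite /rnorm normr0. Qed.

Lemma rnormN x : rnorm (- x) = rnorm x.
Proof. by rewrite /rnorm normrN. Qed.

Lemma rnormD x y : rnorm (x + y) <= rnorm x + rnorm y.
Proof. by have := ler_normD x y; rewrite !rnormE -rmorphD lecR. Qed.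

Lemma rnormB x y : rnorm (x - y) <= rnorm x + rnorm y.
Proof. by rewrite -(rnormN y) rnormD. Qed.

Lemma rnormZ (a : R[i]) x : rnorm (a *: x) = cabs a * rnorm x.
Proof. by apply: complexI; rewrite rmorphM /= -rnormE -cabsE -rnormE normrZ. Qed.

Lemma rnormM x y : rnorm (cmul x y) <= rnorm x * rnorm y.
Proof. by have := cnormM x y; rewrite !rnormE -rmorphM lecR. Qed.

Lemma rnorm_sqabs x : rnorm (cmul (star x) x) = rnorm x ^+ 2.
Proof. by apply: complexI; rewrite rmorphXn /= -!rnormE cstar_id. Qed.

Lemma cmul0x x : cmul 0 x = 0.
Proof. by apply: (addrI (cmul 0 x)); rewrite -cmulDl !addr0. Qed.

Lemma cmulx0 x : cmul x 0 = 0.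
Proof. by apply: (addrI (cmul x 0)); rewrite -cmulDr !addr0. Qed.

Lemma cmulNx x y : cmul (- x) y = - cmul x y.
Proof. by apply: (addrI (cmul x y)); rewrite -cmulDl !subrr cmul0x. Qed.

Lemma cmulxN x y : cmul x (- y) = - cmul x y.
Proof. by apply: (addrI (cmul x y)); rewrite -cmulDr !subrr cmulx0. Qed.

Lemma star0 : star (0 : A) = 0.
Proof. by apply: (addrI (star 0)); rewrite -starD !addr0. Qed.

Lemma starN x : star (- x) = - star x.
Proof. by apply: (addrI (star x)); rewrite -starD !subrr star0. Qed.

Lemma rnorm_star x : rnorm (star x) = rnorm x.
Proof.
have le_star y : rnorm y <= rnorm (star y).
  have [->|y0] := eqVneq (rnorm y) 0; first exact: rnorm_ge0.
  have ygt0 : 0 < rnorm y by rewrite lt_def y0 rnorm_ge0.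
  by rewrite -(ler_pM2r ygt0) -expr2 -rnorm_sqabs rnormM.
by apply/le_anti; rewrite le_star -{2}(starK x) le_star.
Qed.

End RealNorm.

(* The unitization normed by the larger of the norm of its left action on A and
   the modulus of its scalar part.  This is a complete C*-norm whether or not A
   already has a unit; [ubnd u c] says that the norm of [u] is at most [c]. *)
Section Unitization.
Context {R : realType} {A : cstarAlgType R}.

Definition unitization : Type := (A * R[i]^o)%type.

HB.instance Definition _ := GRing.Lmodule.copy unitization (A * R[i]^o)%type.

Implicit Types u v w : unitization.

Let umul u v : unitization := unitization_mul u v.
Let uone : unitization := (0, 1).

Fact umulA : associative umul.
Proof.
move=> [x a] [y b] [z c]; rewrite /umul /unitization_mul /=; congr (_, _).
  rewrite !cmulDl !cmulDr -!cscalerAl -!cscalerAr cmulA !scalerDr !scalerA.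
  by rewrite (mulrC a c) (mulrC b c) !addrA [RHS](ACl (1*3*5*2*4*6*7)).
exact: mulrA.
Qed.

Fact umul1x : left_id uone umul.
Proof.
by case=> x a; rewrite /umul /unitization_mul /= cmul0x scaler0 scale1r addr0
  add0r mul1r.
Qed.

Fact umulx1 : right_id uone umul.
Proof.
by case=> x a; rewrite /umul /unitization_mul /= cmulx0 scaler0 scale1r addr0
  add0r mulr1.
Qed.

Fact umulDl : left_distributive umul +%R.
Proof.
move=> [x a] [y b] [z c]; rewrite /umul /unitization_mul /=; congr (_, _).
  by rewrite cmulDl scalerDl scalerDr /= !addrA [RHS](ACl (1*4*2*5*3*6)).
exact: mulrDl.
Qed.

Fact umulDr : right_distributive umul +%R.
Proof.
move=> [x a] [y b] [z c]; rewrite /umul /unitization_mul /=; congr (_, _).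
  by rewrite cmulDr scalerDl scalerDr /= !addrA [RHS](ACl (1*4*2*5*3*6)).
exact: mulrDr.
Qed.

Fact uone_neq0 : uone != 0.
Proof. by apply/eqP => -[] /eqP; rewrite oner_eq0. Qed.

HB.instance Definition _ := GRing.Zmodule_isNzRing.Build unitization
  umulA umul1x umulx1 umulDl umulDr uone_neq0.

Fact uscalerAl (a : R[i]) u v : a *: (u * v) = (a *: u) * v.
Proof.
case: u v => [x b] [y c]; congr (_, _).
  by rewrite /= !scalerDr cscalerAl !scalerA (mulrC c).
exact: mulrA.
Qed.

HB.instance Definition _ :=
  GRing.Lmodule_isLalgebra.Build R[i] unitization uscalerAl.

Fact uscalerAr (a : R[i]) u v : a *: (u * v) = u * (a *: v).
Proof.
case: u v => [x b] [y c]; congr (_, _).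
  by rewrite /= !scalerDr cscalerAr !scalerA [in RHS](mulrC b).
exact: mulrCA.
Qed.

HB.instance Definition _ :=
  GRing.Lalgebra_isAlgebra.Build R[i] unitization uscalerAr.

Definition uinj (x : A) : unitization := (x, 0).

Definition ustar u : unitization := (star u.1, conjc u.2).

Lemma ustarD u v : ustar (u + v) = ustar u + ustar v.
Proof. by rewrite /ustar /= starD raddfD. Qed.

Lemma ustarM u v : ustar (u * v) = ustar v * ustar u.
Proof.
case: u v => [x b] [y c]; congr (_, _) => /=.
  by rewrite !starD !starZ starM -addrA [X in _ + X]addrC addrA.
by rewrite rmorphM mulrC.
Qed.

Lemma ustarZ (a : R[i]) u : ustar (a *: u) = conjc a *: ustar u.
Proof. by case: u => x b; congr (_, _); rewrite /= ?starZ// rmorphM. Qed.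

Lemma ustarK : involutive ustar.
Proof. by case=> x b; rewrite /ustar /= starK conjcK. Qed.

Lemma ustarN u : ustar (- u) = - ustar u.
Proof. by rewrite /ustar /= starN raddfN. Qed.

Lemma ustarB u v : ustar (u - v) = ustar u - ustar v.
Proof. by rewrite ustarD ustarN. Qed.

Lemma ustar1 : ustar 1 = 1.
Proof. by rewrite /ustar star0 conjc1. Qed.

Lemma ustar0 : ustar 0 = 0.
Proof. by rewrite /ustar star0 conjc0. Qed.

Definition uact u (z : A) : A := cmul u.1 z + u.2 *: z.

Lemma uactD u v z : uact (u + v) z = uact u z + uact v z.
Proof. by rewrite /uact cmulDl scalerDl addrACA. Qed.

Lemma uactM u v z : uact (u * v) z = uact u (uact v z).
Proof.
case: u v => [x a] [y b]; rewrite /uact /= !cmulDl cmulDr -!cscalerAl -cscalerAr.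
by rewrite scalerDr scalerA cmulA !addrA [RHS](ACl (1*3*2*4)).
Qed.

Lemma uactZ (a : R[i]) u z : uact (a *: u) z = a *: uact u z.
Proof. by rewrite /uact /= scalerDr cscalerAl scalerA. Qed.

Lemma cmul_uact u x z : cmul (star (uact u x)) z = cmul (star x) (uact (ustar u) z).
Proof.
by rewrite /uact /= starD starM starZ cmulDl cmulDr -cmulA -cscalerAl cscalerAr.
Qed.

Definition ubnd u (c : R) : Prop :=
  (forall z, rnorm (uact u z) <= c * rnorm z) /\ cabs u.2 <= c.

Lemma ubnd_ge0 u c : ubnd u c -> 0 <= c.
Proof. by case=> _; apply: le_trans; exact: cabs_ge0. Qed.

Lemma ubnd_le u c d : c <= d -> ubnd u c -> ubnd u d.
Proof.
move=> cd [uc ac]; split; last exact: le_trans cd.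
by move=> z; apply: (le_trans (uc z)); rewrite ler_wpM2r ?rnorm_ge0.
Qed.

Lemma ubnd_exists u : exists2 c, 0 < c & ubnd u c.
Proof.
exists (rnorm u.1 + cabs u.2 + 1).
  by rewrite ltr_wpDl// addr_ge0// ?rnorm_ge0// cabs_ge0.
have le1 : rnorm u.1 + cabs u.2 <= rnorm u.1 + cabs u.2 + 1 by rewrite lerDl.
apply: (ubnd_le le1); split; last by rewrite lerDr rnorm_ge0.
by move=> z; rewrite (le_trans (rnormD _ _))// mulrDl lerD// ?rnormM// rnormZ.
Qed.

Lemma ubndZ (a : R[i]) u c : ubnd u c -> ubnd (a *: u) (cabs a * c).
Proof.
case=> uc ac; split => [z|]; last by rewrite cabsM ler_wpM2l// cabs_ge0.
by rewrite uactZ rnormZ -mulrA ler_wpM2l// cabs_ge0.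
Qed.

Lemma ubndN u c : ubnd u c -> ubnd (- u) c.
Proof.
by move/(ubndZ (-1)); rewrite scaleN1r cabsN (cabs_real 1) normr1 mul1r.
Qed.

Lemma ubndD u v c d : ubnd u c -> ubnd v d -> ubnd (u + v) (c + d).
Proof.
move=> [uc ac] [vd bd]; split => [z|]; last by rewrite (le_trans (cabsD _ _))// lerD.
by rewrite uactD (le_trans (rnormD _ _))// mulrDl lerD.
Qed.

Lemma ubndB u v c d : ubnd u c -> ubnd v d -> ubnd (u - v) (c + d).
Proof. by move=> uc /ubndN; exact: ubndD. Qed.

Lemma ubndM u v c d : ubnd u c -> ubnd v d -> ubnd (u * v) (c * d).
Proof.
move=> bu [vd bd]; have c0 := ubnd_ge0 bu; case: bu => uc ac; split => [z|].
  by rewrite uactM (le_trans (uc _))// -mulrA ler_wpM2l.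
by rewrite cabsM ler_pM// cabs_ge0.
Qed.

Lemma scalarE (a : R[i]) : a%:A = (0, a) :> unitization.
Proof. by congr (_, _); [exact: scaler0 | exact: mulr1]. Qed.

Lemma ubnd_scalar (a : R[i]) : ubnd a%:A (cabs a).
Proof.
by rewrite scalarE; split=> [z|//]; rewrite /uact /= cmul0x add0r rnormZ.
Qed.

Lemma ubnd1 : ubnd 1 1.
Proof. by have := ubnd_scalar 1; rewrite scale1r (cabs_real 1) normr1. Qed.

Lemma ubnd0 : ubnd 0 0.
Proof. by have := ubndZ 0 ubnd1; rewrite scale0r (cabs_real 0) normr0 mul0r. Qed.

Lemma ubnd_uinj x : ubnd (uinj x) (rnorm x).
Proof.
split=> [z|]; last by rewrite (cabs_real 0) normr0 rnorm_ge0.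
by rewrite /uact /= scale0r addr0 rnormM.
Qed.

Lemma ubnd_cstar u c : 0 <= c -> ubnd (ustar u * u) (c ^+ 2) -> ubnd u c.
Proof.
move=> c0 [uc ac]; split => [z|]; last first.
  by rewrite -(ler_pXn2r (n := 2))// ?nnegrE ?cabs_ge0// expr2 -{1}cabsJ -cabsM.
rewrite -(ler_pXn2r (n := 2))// ?nnegrE ?rnorm_ge0 ?mulr_ge0 ?rnorm_ge0//.
rewrite -rnorm_sqabs cmul_uact -uactM (le_trans (rnormM _ _))// rnorm_star.
have -> : (c * rnorm z) ^+ 2 = rnorm z * (c ^+ 2 * rnorm z) by ring.
by rewrite ler_wpM2l ?rnorm_ge0.
Qed.

Lemma ubnd_star u c : ubnd u c -> ubnd (ustar u) c.
Proof.
move=> bu; have c0 := ubnd_ge0 bu; case: bu => uc ac.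
split => [z|]; last by rewrite cabsJ.
have [->|w0] := eqVneq (rnorm (uact (ustar u) z)) 0.
  by rewrite mulr_ge0// rnorm_ge0.
have wgt0 : 0 < rnorm (uact (ustar u) z) by rewrite lt_def w0 rnorm_ge0.
rewrite -(ler_pM2r wgt0) -expr2 -rnorm_sqabs cmul_uact ustarK.
rewrite (le_trans (rnormM _ _))// rnorm_star (mulrC c) -mulrA.
by rewrite ler_wpM2l ?rnorm_ge0.
Qed.

Lemma ubnd_rnorm u c : ubnd u c -> rnorm u.1 <= c + c.
Proof.
move=> [uc ac]; have [->|x0] := eqVneq (rnorm u.1) 0.
  by rewrite addr_ge0// (le_trans (cabs_ge0 _) ac).
have xgt0 : 0 < rnorm u.1 by rewrite lt_def x0 rnorm_ge0.
rewrite -(ler_pM2r xgt0) -expr2 -{1}rnorm_star -rnorm_sqabs starK.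
have -> : cmul u.1 (star u.1) = uact u (star u.1) - u.2 *: star u.1.
  by rewrite /uact addrK.
rewrite (le_trans (rnormB _ _))// rnormZ mulrDl -(rnorm_star u.1) lerD//.
by rewrite ler_wpM2r ?rnorm_ge0.
Qed.

Lemma ubnd_eq0 u : (forall e, 0 < e -> ubnd u e) -> u = 0.
Proof.
move=> u0; case: u u0 => x a u0.
have a0 : a = 0.
  apply: cabs_eq0; apply/le_anti; rewrite cabs_ge0 andbT.
  by apply/ler_addgt0Pl => e /u0[_]; rewrite addr0.
congr (_, _) => //; apply: rnorm_eq0; apply/le_anti; rewrite rnorm_ge0 andbT.
apply/ler_addgt0Pl => e e0; rewrite addr0 (splitr e).
by apply: (ubnd_rnorm (u := (x, a))); apply: u0; rewrite divr_gt0.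
Qed.

End Unitization.
Arguments unitization {R} A.

Section Completeness.
Context {R : realType} {A : cstarAlgType R}.

Lemma gt0_complexE (e : R[i]) : 0 < e -> exists2 r : R, 0 < r & e = r%:C%C.
Proof.
case: e => a b; rewrite ltcE /= => /andP[/eqP b0 a0].
by exists a => //; rewrite b0.
Qed.

Lemma real_complete (x : nat -> R) :
  (forall e : R, 0 < e -> exists N, forall n, (N <= n)%N -> `|x n - x N| <= e) ->
  exists l : R, forall e : R, 0 < e ->
    exists N, forall n, (N <= n)%N -> `|x n - l| <= e.
Proof.
move=> cx; have : cvg (x @ \oo).
  apply/cauchy_cvgP/cauchy_exP => e e0.
  have [|N xN] := cx (e / 2); first by rewrite divr_gt0.
  exists (x N); exists N => // n /= Nn; rewrite /ball /= distrC.
  by rewrite (le_lt_trans (xN _ Nn))// ltr_pdivrMr// ltr_pMr// ltr1n.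
case/cvg_ex => l xl; exists l => e e0.
by move/cvgrPdistC_le : xl => /(_ _ e0)[N _ xN]; exists N => n Nn; exact: xN.
Qed.

Lemma cstar_complete (x : nat -> A) :
  (forall e : R, 0 < e -> exists N, forall n, (N <= n)%N -> rnorm (x n - x N) <= e) ->
  exists l, forall e : R, 0 < e ->
    exists N, forall n, (N <= n)%N -> rnorm (x n - l) <= e.
Proof.
move=> cx; have : cvg (x @ \oo).
  apply/cauchy_cvgP/cauchy_exP => _ /gt0_complexE[e e0 ->].
  have [|N xN] := cx (e / 2); first by rewrite divr_gt0.
  exists (x N); exists N => // n /= Nn; rewrite -ball_normE /ball_ /=.
  rewrite distrC rnormE ltcR.
  by rewrite (le_lt_trans (xN _ Nn))// ltr_pdivrMr// ltr_pMr// ltr1n.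
case/cvg_ex => l xl; exists l => e e0.
have e0' : (0 : R[i]) < e%:C%C by rewrite ltcR.
move/cvgrPdistC_le : xl => /(_ _ e0')[N _ xN]; exists N => n Nn.
by have := xN n Nn; rewrite rnormE lecR.
Qed.

Implicit Types (u v : unitization A) (s t : nat -> unitization A).

Definition ucvg s u : Prop :=
  forall e : R, 0 < e -> exists N, forall n, (N <= n)%N -> ubnd (s n - u) e.

Lemma ubnd_max u : ubnd u (rnorm u.1 + cabs u.2).
Proof.
split=> [z|]; last by rewrite lerDr rnorm_ge0.
by rewrite (le_trans (rnormD _ _))// mulrDl lerD// ?rnormM// rnormZ.
Qed.

Lemma unitization_complete s :
  (forall e : R, 0 < e -> exists N, forall n, (N <= n)%N -> ubnd (s n - s N) e) ->
  exists u, ucvg s u.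
Proof.
move=> cs.
have [x sx] : exists x, forall e : R, 0 < e ->
    exists N, forall n, (N <= n)%N -> rnorm ((s n).1 - x) <= e.
  apply: cstar_complete => e e0; have [|N sN] := cs (e / 2); first by rewrite divr_gt0.
  by exists N => n /sN/ubnd_rnorm; rewrite -splitr.
have [a sa] : exists a, forall e : R, 0 < e ->
    exists N, forall n, (N <= n)%N -> `|complex.Re (s n).2 - a| <= e.
  apply: real_complete => e e0; have [N sN] := cs _ e0.
  exists N => n /sN[_]; apply: le_trans; rewrite -raddfB; exact: Re_le_cabs.
have [b sb] : exists a, forall e : R, 0 < e ->
    exists N, forall n, (N <= n)%N -> `|complex.Im (s n).2 - a| <= e.
  apply: real_complete => e e0; have [N sN] := cs _ e0.
  exists N => n /sN[_]; apply: le_trans; rewrite -raddfB; exact: Im_le_cabs.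
exists (x, Complex a b) => e e0; have e3 : 0 < e / 3 by rewrite divr_gt0.
have [N1 s1] := sx _ e3; have [N2 s2] := sa _ e3; have [N3 s3] := sb _ e3.
exists (maxn N1 (maxn N2 N3)) => n; rewrite !geq_max => /and3P[n1 n2 n3].
apply: ubnd_le (ubnd_max _).
have -> : e = e / 3 + (e / 3 + e / 3) by field.
rewrite lerD ?s1// (le_trans (cabs_le _))// lerD//.
  by rewrite raddfB s2.
by rewrite raddfB s3.
Qed.

Lemma unitization_complete_rate s (b : nat -> R) (M : R) :
  (forall n, ubnd (s n.+1 - s n) (b n.+1 - b n)) -> (forall n, b n <= M) ->
  exists u, ucvg s u.
Proof.
move=> sb bM; have sbn N k : ubnd (s (k + N)%N - s N) (b (k + N)%N - b N).
  elim: k => [|k IH].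
    by rewrite add0n !subrr; exact: ubnd0.
  have := ubndD (sb (k + N)%N) IH.
  by rewrite !addrA !subrK.
have hb : has_sup (range b).
  by split; [exists (b 0%N), 0%N|exists M => _ [n _ <-]].
apply: unitization_complete => e e0.
have [_ [N _ <-] bN] := sup_adherent e0 hb.
exists N => n Nn; rewrite -(subnK Nn); apply: ubnd_le (sbn _ _).
rewrite lerBlDl -lerBlDr; apply: le_trans (ltW bN).
by rewrite lerB// sup_upper_bound//; exists (n - N + N)%N.
Qed.

Lemma ubnd_lim u c : (forall e : R, 0 < e -> ubnd u (c + e)) -> ubnd u c.
Proof.
move=> uc; split => [z|]; last first.
  by apply/ler_addgt0Pl => e /uc[_]; rewrite addrC.
have [z0|z0] := eqVneq (rnorm z) 0.
  by have [/(_ z)] := uc 1 ltr01; rewrite z0 !mulr0.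
have zgt0 : 0 < rnorm z by rewrite lt_def z0 rnorm_ge0.
apply/ler_addgt0Pr => e e0; have [/(_ z)] := uc (e / rnorm z) (divr_gt0 e0 zgt0).
by rewrite mulrDl divfK.
Qed.

Lemma ubnd_approx u c :
  (forall e : R, 0 < e -> exists2 v, ubnd v c & ubnd (u - v) e) -> ubnd u c.
Proof.
move=> uv; apply: ubnd_lim => e /uv[v vc uve].
by rewrite -(subrK v u) addrC; exact: ubndD.
Qed.

Lemma ucvg_ubnd s u c : (forall n, ubnd (s n) c) -> ucvg s u -> ubnd u c.
Proof.
move=> sc su; apply: ubnd_approx => e /su[N sN]; exists (s N) => //.
by rewrite -opprB; apply: ubndN; exact: sN.
Qed.

Lemma ucvg_unique s u v : ucvg s u -> ucvg s v -> u = v.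
Proof.
move=> su sv; apply/subr0_eq/ubnd_eq0 => e e0.
have e2 : 0 < e / 2 by rewrite divr_gt0.
have [N1 s1] := su _ e2; have [N2 s2] := sv _ e2.
have -> : u - v = (s (maxn N1 N2) - v) - (s (maxn N1 N2) - u).
  by rewrite opprB [RHS]addrC addrA subrK.
by rewrite (splitr e); apply: ubndB; [apply: s2|apply: s1];
  rewrite ?leq_maxl ?leq_maxr.
Qed.

Lemma ucvg_cst u : ucvg (fun=> u) u.
Proof.
move=> e e0; exists 0%N => n _; rewrite subrr.
by apply: ubnd_le ubnd0; exact: ltW.
Qed.

Lemma ucvg_shift s u : ucvg s u -> ucvg (fun n => s n.+1) u.
Proof.
by move=> su e /su[N sN]; exists N => n Nn; apply: sN; exact: leqW.
Qed.

Lemma ucvgD s t u v : ucvg s u -> ucvg t v -> ucvg (fun n => s n + t n) (u + v).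
Proof.
move=> su tv e e0; have e2 : 0 < e / 2 by rewrite divr_gt0.
have [N1 s1] := su _ e2; have [N2 s2] := tv _ e2.
exists (maxn N1 N2) => n; rewrite geq_max => /andP[n1 n2].
by rewrite (splitr e) opprD addrACA; apply: ubndD; [exact: s1|exact: s2].
Qed.

Lemma ucvg_star s u : ucvg s u -> ucvg (fun n => ustar (s n)) (ustar u).
Proof.
by move=> su e /su[N sN]; exists N => n /sN/ubnd_star; rewrite ustarB.
Qed.

Lemma ucvgM s t u v : ucvg s u -> ucvg t v -> ucvg (fun n => s n * t n) (u * v).
Proof.
move=> su tv e e0; have [c c0 uc] := ubnd_exists u.
have [d d0 vd] := ubnd_exists v.
have [|N1 s1] := su (Num.min 1 (e / 2 / d)).
  by rewrite lt_min ltr01 !divr_gt0.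
have [|N2 s2] := tv (e / 2 / (c + 1)); first by rewrite !divr_gt0// addr_gt0.
exists (maxn N1 N2) => n; rewrite geq_max => /andP[/s1 n1 /s2 n2].
have -> : s n * t n - u * v = s n * (t n - v) + (s n - u) * v.
  by rewrite mulrBr mulrBl addrA subrK.
have sc : ubnd (s n) (c + 1).
  rewrite -(subrK u (s n)) addrC; apply: ubndD => //.
  by apply: ubnd_le n1; rewrite ge_min lexx.
rewrite (splitr e); apply: ubndD.
  by have := ubndM sc n2; rewrite mulrC divfK// gt_eqF// addr_gt0.
have n1' : ubnd (s n - u) (e / 2 / d) by apply: ubnd_le n1; rewrite ge_min lexx orbT.
by have := ubndM n1' vd; rewrite divfK// gt_eqF.
Qed.

Lemma ucvgZ (a : R[i]) s u : ucvg s u -> ucvg (fun n => a *: s n) (a *: u).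
Proof.
move=> su; have := ucvgM (ucvg_cst a%:A) su.
rewrite mulr_algl => h e /h[N hN]; exists N => n /hN.
by rewrite mulr_algl.
Qed.

End Completeness.
(** * Positive elements *)

Lemma conjc_i {R : realType} : conjc 'i%C = - 'i%C :> R[i].
Proof. by apply/eqP; rewrite eq_complex /= oppr0 !eqxx. Qed.

Section PositiveElements.
Context {R : realType} {A : cstarAlgType R}.
Implicit Types (u v b c g h : unitization A) (r t : R).

Lemma scale_half_double u : (2^-1 : R)%:C%C *: (u + u) = u.
Proof.
rewrite scalerDr -scalerDl -rmorphD /= -[RHS]scale1r; congr (_%:C%C *: _).
by field.
Qed.

(* 1 - sqrt (1 - c) is the limit of the iteration b' = (c + b^2) / 2, dominated
   by the corresponding real iteration for c = 1. *)
Lemma unitization_sqrt c : ustar c = c -> ubnd c 1 ->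
  exists b, [/\ ustar b = b, ubnd b 1, (1 - b) * (1 - b) = 1 - c &
    forall x, GRing.comm x c -> GRing.comm x b].
Proof.
move=> cs c1.
pose s n := iter n (fun b => (2^-1 : R)%:C%C *: (c + b * b)) 0.
pose m n := iter n (fun x : R => 2^-1 * (1 + x * x)) 0.
have sS n : s n.+1 = (2^-1 : R)%:C%C *: (c + s n * s n) by [].
have mS n : m n.+1 = 2^-1 * (1 + m n * m n) by [].
have half : cabs (2^-1 : R)%:C%C = 2^-1.
  by rewrite cabs_real ger0_norm.
have sm n : ubnd (s n) (m n).
  elim: n => [|n IH]; first exact: ubnd0.
  by have := ubndZ (2^-1 : R)%:C%C (ubndD c1 (ubndM IH IH)); rewrite half.
have m0 n : 0 <= m n by exact: ubnd_ge0 (sm n).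
have m1 n : m n <= 1.
  elim: n => [|n IH]; first exact: ler01.
  rewrite mS ler_pdivrMl// mulr1 -[leRHS]/(1 + 1) lerD2l.
  by rewrite mulr_ile1.
have [b sb] : exists b, ucvg s b.
  apply: (@unitization_complete_rate _ _ s m 1) => // n.
  elim: n => [|n IH].
    have := ubndZ (2^-1 : R)%:C%C c1.
    by rewrite /s /m /= half !subr0 !mulr0 !addr0.
  have -> : s n.+2 - s n.+1 = (2^-1 : R)%:C%C *:
      ((s n.+1 - s n) * s n.+1 + s n * (s n.+1 - s n)).
    rewrite (sS n.+1) {3}(sS n) -scalerBr; congr (_ *: _).
    by rewrite mulrBl mulrBr addrA subrK opprD addrACA subrr add0r.
  have -> : m n.+2 - m n.+1 = 2^-1 *
      ((m n.+1 - m n) * m n.+1 + m n * (m n.+1 - m n)).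
    by rewrite (mS n.+1) {3}(mS n); ring.
  have := ubndZ (2^-1 : R)%:C%C (ubndD (ubndM IH (sm n.+1)) (ubndM (sm n) IH)).
  by rewrite half.
have bE : b + b = c + b * b.
  have {1 2}-> : b = (2^-1 : R)%:C%C *: (c + b * b).
    apply: (ucvg_unique (ucvg_shift sb)).
    by apply: ucvgZ; apply: ucvgD; [exact: ucvg_cst|exact: ucvgM].
  by rewrite -scalerDr scale_half_double.
exists b; split.
- have ss n : ustar (s n) = s n.
    by elim: n => [|n IH]; rewrite ?ustar0// sS ustarZ
      conjc_real ustarD ustarM IH cs.
  have := ucvg_star sb; under [X in ucvg X]funext do rewrite ss.
  by move/ucvg_unique; apply.
- exact: (ucvg_ubnd (fun n => ubnd_le (m1 n) (sm n)) sb).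
- have -> : c = b + b - b * b by rewrite bE addrK.
  by rewrite mulrBl mul1r mulrBr mulr1 -addrA -opprD addrA.
- move=> x xc; have xs n : x * s n = s n * x.
    elim: n => [|n IH]; first by rewrite mulr0 mul0r.
    rewrite sS -scalerAl -scalerAr mulrDr mulrDl xc.
    by rewrite -[in RHS]mulrA -IH !mulrA IH.
  apply: ucvg_unique (ucvgM (ucvg_cst x) sb) _ => /=.
  by under [X in ucvg X]funext do rewrite xs; exact: ucvgM sb (ucvg_cst x).
Qed.

Definition uge0 g : Prop := ustar g = g /\ exists t, ubnd (t%:C%C%:A - g) t.

Lemma real_comm x r u : GRing.comm x u -> GRing.comm x (r%:C%C *: u).
Proof. by move=> xu; rewrite /GRing.comm -scalerAr xu scalerAl. Qed.

(* For k = h / t and s = sqrt (1 - k^2) the element k + i s is unitary, so that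
   |s| <= 1. *)
Lemma ubnd_sub_sqr h t : ustar h = h -> 0 < t -> ubnd h t ->
  ubnd ((t ^+ 2)%:C%C%:A - h * h) (t ^+ 2).
Proof.
move=> hs t0 ht; have [k kE] : exists k, k = (t^-1)%:C%C *: h by eexists.
have k1 : ubnd k 1.
  rewrite kE; have := ubndZ (t^-1)%:C%C ht.
  by rewrite cabs_real ger0_norm ?invr_ge0 ?ltW// mulVf ?gt_eqF.
have ks : ustar k = k by rewrite kE ustarZ conjc_real hs.
have kk1 : ubnd (k * k) 1 by have := ubndM k1 k1; rewrite mulr1.
have [|b [bs b1 bE cb]] := unitization_sqrt _ kk1; first by rewrite ustarM ks.
have [s sE] : exists s, s = 1 - b by eexists.
have ss : ustar s = s by rewrite sE ustarB ustar1 bs.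
have ksC : k * s = s * k.
  by rewrite sE; apply: commrB (commr1 _) (cb _ _); rewrite /GRing.comm mulrA.
pose u := k + 'i%C *: s.
have us : ustar u = k - 'i%C *: s.
  by rewrite ustarD ks ustarZ ss conjc_i scaleNr.
have ii : 'i%C * 'i%C = -1 :> R[i] by rewrite -expr2 sqr_i.
have uu : ustar u * u = 1.
  rewrite us /u mulrBl !mulrDr -!scalerAl -!scalerAr scalerA ii scaleN1r ksC.
  by rewrite opprD opprK addrA addrK sE bE addrC subrK.
have u1 : ubnd u 1.
  by apply: ubnd_cstar => //; rewrite uu expr1n; exact: ubnd1.
have s1 : ubnd s 1.
  have -> : s = (2^-1 : R)%:C%C *: ('i%C *: (ustar u - u)).
    rewrite us /u opprD addrACA subrr add0r -opprD scalerN scalerDr scalerA ii.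
    rewrite scaleN1r -opprD opprK -[in RHS](scale1r s) -scalerDl scalerA.
    by rewrite -[LHS]scale1r; congr (_ *: _); rewrite -(rmorph1 (real_complex R))
     -rmorphD -rmorphM; congr (_%:C%C); field.
  have := ubndZ (2^-1 : R)%:C%C (ubndZ 'i%C (ubndB (ubnd_star u1) u1)).
  rewrite cabs_i cabs_real ger0_norm//.
  by have -> : (2^-1 * (1 * (1 + 1)) = 1 :> R) by field.
have := ubndZ (t ^+ 2)%:C%C (ubndM s1 s1).
rewrite mulr1 cabs_real ger0_norm ?sqr_ge0// mulr1 sE bE kE scalerBr.
rewrite -scalerAl -scalerAr !scalerA -!rmorphM /=.
by have -> : t ^+ 2 * t^-1 * t^-1 = 1; [field; rewrite gt_eqF|rewrite scale1r].
Qed.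

Lemma uge0_sqr h : ustar h = h -> uge0 (h * h).
Proof.
move=> hs; split; first by rewrite ustarM hs.
by have [t t0 ht] := ubnd_exists h; exists (t ^+ 2); exact: ubnd_sub_sqr.
Qed.

Lemma uge0D g h : uge0 g -> uge0 h -> uge0 (g + h).
Proof.
move=> [gs [t gt]] [hs [r hr]]; split; first by rewrite ustarD gs hs.
by exists (t + r); rewrite rmorphD scalerDl opprD addrACA; exact: ubndD.
Qed.

Lemma uge0Z r g : 0 <= r -> uge0 g -> uge0 (r%:C%C *: g).
Proof.
move=> r0 [gs [t gt]]; split; first by rewrite ustarZ conjc_real gs.
exists (r * t); rewrite rmorphM -scalerA -scalerBr.
by have := ubndZ r%:C%C gt; rewrite cabs_real ger0_norm.
Qed.

Lemma uge0_sqrt g : uge0 g -> exists h, [/\ uge0 h, h * h = g &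
  forall x, GRing.comm x g -> GRing.comm x h].
Proof.
move=> [gs [t tg]]; have t0 := ubnd_ge0 tg; pose r := t + 1.
have r0 : 0 < r by rewrite ltr_wpDl.
have rg : ubnd (r%:C%C%:A - g) r.
  by rewrite rmorphD scalerDl rmorph1 scale1r addrAC; apply: ubndD ubnd1.
pose c := 1 - (r^-1)%:C%C *: g.
have c1 : ubnd c 1.
  have := ubndZ (r^-1)%:C%C rg.
  rewrite cabs_real ger0_norm ?invr_ge0 ?ltW// mulVf ?gt_eqF//.
  by rewrite scalerBr scalerA -rmorphM /= mulVf ?gt_eqF// rmorph1 scale1r.
have [|b [bs b1 bE cb]] := unitization_sqrt _ c1.
  by rewrite ustarB ustar1 ustarZ conjc_real gs.
exists ((Num.sqrt r)%:C%C *: (1 - b)); split.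
- apply: uge0Z; first exact: sqrtr_ge0.
  split; first by rewrite ustarB ustar1 bs.
  by exists 1; rewrite rmorph1 scale1r opprB addrC subrK.
- rewrite -scalerAl -scalerAr scalerA bE -rmorphM -expr2 sqr_sqrtr ?ltW//.
  by rewrite opprB addrC subrK scalerA -rmorphM divff ?gt_eqF// rmorph1 scale1r.
- move=> x xg; apply/real_comm/commrB; first exact: commr1.
  by apply: cb; apply: commrB (commr1 _) _; exact: real_comm.
Qed.

Lemma ustar_mul_eq0 u : ustar u * u = 0 -> u = 0.
Proof.
move=> u0; apply: ubnd_eq0 => e e0; apply: ubnd_cstar; first exact: ltW.
by rewrite u0; apply: ubnd_le ubnd0; rewrite exprn_ge0// ltW.
Qed.

Lemma sqr_eq0 h : ustar h = h -> h * h = 0 -> h = 0.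
Proof. by move=> hs hh; apply: ustar_mul_eq0; rewrite hs. Qed.

Lemma uge0_anti g : uge0 g -> uge0 (- g) -> g = 0.
Proof.
move=> /uge0_sqrt[h [[hs _] hg ch]] /uge0_sqrt[k [[ks _] kg ck]].
have hk : h * k = k * h.
  by apply: ck; apply: commrN; apply/commr_sym/ch.
have u0 : h + 'i%C *: k = 0.
  apply: ustar_mul_eq0; rewrite ustarD ustarZ hs ks.
  rewrite conjc_i scaleNr mulrBl !mulrDr -!scalerAl -!scalerAr scalerA.
  rewrite -[_ * 'i%C]expr2 sqr_i scaleN1r hk opprD opprK addrA addrK hg kg.
  by rewrite subrr.
have v0 : h - 'i%C *: k = 0.
  have := congr1 (@ustar _ A) u0; rewrite ustar0 ustarD ustarZ hs ks.
  by rewrite conjc_i scaleNr.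
have : h + h = 0.
  by rewrite -[LHS]addr0 -[X in _ + X](subrr ('i%C *: k)) addrACA u0 v0 addr0.
by move=> h0; rewrite -hg -[h]scale_half_double h0 scaler0 mul0r.
Qed.

Lemma uge0_commM g h : uge0 g -> ustar h = h -> GRing.comm g h -> uge0 (g * (h * h)).
Proof.
move=> /uge0_sqrt[r [[rs _] rg cr]] hs gh.
have hr : h * r = r * h by apply: cr; apply/commr_sym.
have -> : g * (h * h) = (r * h) * (r * h).
  by rewrite -rg -!mulrA; congr (_ * _); rewrite [RHS]mulrA hr -mulrA.
by apply: uge0_sqr; rewrite ustarM rs hs hr.
Qed.

Lemma uge0_add_swap w : uge0 (w * ustar w + ustar w * w).
Proof.
set v := ustar w.
have vs : ustar v = w by rewrite /v ustarK.
have x0 : uge0 ((w + v) * (w + v)) by apply: uge0_sqr; rewrite ustarD vs addrC.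
have y0 : uge0 (('i%C *: (v - w)) * ('i%C *: (v - w))).
  apply: uge0_sqr; rewrite ustarZ ustarB vs conjc_i scaleNr -scalerN opprB.
  by [].
have -> : w * v + v * w = (2^-1 : R)%:C%C *:
    ((w + v) * (w + v) + ('i%C *: (v - w)) * ('i%C *: (v - w))).
  rewrite -[LHS]scale_half_double; congr (_ *: _).
  rewrite -scalerAl -scalerAr scalerA -[_ * 'i%C]expr2 sqr_i scaleN1r.
  rewrite mulrBl !mulrBr mulrDl !mulrDr !opprD !opprK !addrA.
  by rewrite [RHS](ACl (1*8*4*5*2*3*7*6)) /= subrr add0r subrr add0r.
by apply: uge0Z; [rewrite invr_ge0|exact: uge0D].
Qed.

Lemma ustar_mul_neg z g : ustar z * z = - g -> uge0 g -> z = 0.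
Proof.
move=> zg g0; have [gs _] := g0; have [r [[rs _] rg _]] := uge0_sqrt g0.
have sum0 : g * g + (z * ustar z) * (z * ustar z) = 0.
  apply: uge0_anti.
    by apply: uge0D; apply: uge0_sqr => //; rewrite ustarM ustarK.
  have := uge0_add_swap (z * r); rewrite ustarM rs.
  have -> : z * r * (r * ustar z) = - (z * ustar z * (z * ustar z)).
    by rewrite !mulrA -(mulrA z r) rg -(mulrA z _ z) zg mulrN mulNr opprK.
  have -> : r * ustar z * (z * r) = - (g * g).
    by rewrite !mulrA -(mulrA r _ z) zg mulrN mulNr -rg !mulrA.
  by rewrite -opprD addrC.
have gg0 : g * g = 0.
  apply: uge0_anti; first exact: uge0_sqr.
  move/eqP : sum0; rewrite addr_eq0 => /eqP ->; rewrite opprK.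
  by apply: uge0_sqr; rewrite ustarM ustarK.
by apply: ustar_mul_eq0; rewrite zg (sqr_eq0 gs gg0) oppr0.
Qed.

(* With q = |h| the square root of h^2 and m = q - h, the element z = y m
   satisfies z^* z = m h m = - m^3 / 2 and m^3 = 2 q m^2 is positive; hence
   z = 0, m = 0 and h = q. *)
Lemma uge0_ustar_mul y : uge0 (ustar y * y).
Proof.
have [h hE] : exists h, h = ustar y * y by eexists.
rewrite -hE; have hs : ustar h = h by rewrite hE ustarM ustarK.
have [q [q0 qq cq]] := uge0_sqrt (uge0_sqr hs).
have hq : h * q = q * h by apply: cq; rewrite /GRing.comm mulrA.
have [m mE] : exists m, m = q - h by eexists.
have ms : ustar m = m by rewrite mE ustarB hs; case: q0 => ->.
have hm : h * m = m * h by rewrite mE mulrBl mulrBr hq.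
have qm : q * m = m * q by rewrite mE mulrBl mulrBr hq.
have mm : m * m = (q * m) + (q * m).
  have -> : q * m = q * q - h * q by rewrite mE mulrBr hq.
  by rewrite {1}mE mulrBl {1 2}mE !mulrBr hq qq opprB addrC.
have hmm : h * m + h * m = - (m * m).
  rewrite mm; have -> : h * m = - (q * m).
    by rewrite mE !mulrBr opprB qq hq.
  by rewrite -opprD.
have qmm := uge0_commM q0 ms qm.
have zz : ustar (y * m) * (y * m) = - (q * (m * m)).
  rewrite ustarM ms -!mulrA [ustar y * _]mulrA -hE.
  rewrite -[LHS]scale_half_double -mulrDr hmm mulrN scalerN; congr (- _).
  have mqm : m * (q * m) = q * (m * m) by rewrite [LHS]mulrA -qm -mulrA.
  by rewrite {1}mm mulrDr mqm scale_half_double.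
have qmm0 : q * (m * m) = 0.
  by apply: oppr_inj; rewrite oppr0 -zz (ustar_mul_neg zz qmm) ustar0 mul0r.
have m0 : m = 0.
  apply: sqr_eq0 => //; apply: sqr_eq0; first by rewrite ustarM ms.
  by rewrite {1}mm mulrDl qm -mulrA qmm0 mulr0 addr0.
by have -> : h = q by apply/esym/subr0_eq; rewrite -mE.
Qed.

End PositiveElements.
Section PositiveCone.
Context {R : realType} {A : cstarAlgType R}.
Implicit Types (u v g h : unitization A) (r t : R) (x y : A).

Definition cone x : Prop := uge0 (uinj x).

Lemma uinjD x y : uinj (x + y) = uinj x + uinj y.
Proof. by congr (_, _); rewrite addr0. Qed.

Lemma uinjN x : uinj (- x) = - uinj x.
Proof. by congr (_, _); rewrite oppr0. Qed.

Lemma uinjB x y : uinj (x - y) = uinj x - uinj y.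
Proof. by rewrite uinjD uinjN. Qed.

Lemma uinjM x y : uinj (cmul x y) = uinj x * uinj y.
Proof. by congr (_, _); rewrite /= ?mul0r// !scale0r !addr0. Qed.

Lemma ustar_uinj x : ustar (uinj x) = uinj (star x).
Proof. by congr (_, _); exact: conjc0. Qed.

Lemma cone_sqabs x : cone (sqabs x).
Proof. by rewrite /cone uinjM -ustar_uinj; exact: uge0_ustar_mul. Qed.

Lemma cone_star x : cone x -> star x = x.
Proof. by case; rewrite ustar_uinj => -[]. Qed.

Lemma coneD x y : cone x -> cone y -> cone (x + y).
Proof. by rewrite /cone uinjD; exact: uge0D. Qed.

Lemma coneZ r x : 0 <= r -> cone x -> cone (r%:C%C *: x).
Proof.
move=> r0 /(uge0Z r0); rewrite /cone; congr uge0; congr (_, _).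
exact: mulr0.
Qed.

Lemma uge0_ubnd g t : 0 < t -> uge0 g -> ubnd g t -> ubnd (t%:C%C%:A - g) t.
Proof.
move=> t0 /uge0_sqrt[h [[hs _] hg _]] gt.
have ht : ubnd h (Num.sqrt t).
  by apply: ubnd_cstar; rewrite ?sqrtr_ge0// hs hg sqr_sqrtr// ltW.
have := @ubnd_sub_sqr _ _ h (Num.sqrt t) hs.
by rewrite sqrtr_gt0 hg sqr_sqrtr ?ltW//; apply.
Qed.

Lemma cone_closed x :
  (forall e : R, 0 < e -> exists2 c, cone c & rnorm (x - c) <= e) -> cone x.
Proof.
move=> xc; split.
  rewrite ustar_uinj; congr uinj; apply/subr0_eq/rnorm_eq0/le_anti.
  rewrite rnorm_ge0 andbT; apply/ler_addgt0Pr => e e0; rewrite add0r.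
  have [|c /cone_star cs xce] := xc (e / 2); first by rewrite divr_gt0.
  have -> : star x - x = star (x - c) - (x - c).
    by rewrite starD starN cs opprB addrA subrK.
  by rewrite (le_trans (rnormB _ _))// rnorm_star (splitr e) lerD.
exists (rnorm x + 1); apply: ubnd_approx => e e0.
have [|c c0 xce] := xc (Num.min e 1); first by rewrite lt_min e0 ltr01.
exists ((rnorm x + 1)%:C%C%:A - uinj c).
  apply: uge0_ubnd => //; first by rewrite ltr_wpDl// rnorm_ge0.
  apply: ubnd_le (ubnd_uinj _); rewrite -{1}(subrK x c) addrC.
  rewrite (le_trans (rnormD _ _))// lerD2l -rnormN opprB (le_trans xce)//.
  by rewrite ge_min lexx orbT.
rewrite opprB addrC addrA subrK -opprB -uinjB.
apply: ubndN; apply: ubnd_le (ubnd_uinj _).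
by rewrite (le_trans xce)// ge_min lexx.
Qed.

Definition uinvertible u : Prop := exists v, u * v = 1 /\ v * u = 1.

Lemma uinvertible_sub c r : ubnd c r -> r < 1 -> uinvertible (1 - c).
Proof.
move=> cr r1; pose s n := iter n (fun v => 1 + c * v) 0.
pose b n := (1 - r ^+ n) / (1 - r).
have sS n : s n.+1 = 1 + c * s n by [].
have r0 := ubnd_ge0 cr; have r10 : 0 < 1 - r by rewrite subr_gt0.
have bS n : b n.+1 - b n = r ^+ n.
  by rewrite /b exprS; field; rewrite gt_eqF.
have [v sv] : exists v, ucvg s v.
  apply: (@unitization_complete_rate _ _ s b (1 - r)^-1) => n.
    rewrite bS; elim: n => [|n IH].
      by rewrite /s /= mulr0 addr0 subr0; exact: ubnd1.
    have -> : s n.+2 - s n.+1 = c * (s n.+1 - s n).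
      by rewrite mulrBr !sS opprD addrACA subrr add0r.
    by rewrite exprS; exact: ubndM.
  by rewrite ler_pdivrMr// mulVf ?gt_eqF// gerBl exprn_ge0.
have cs n : c * s n = s n * c.
  elim: n => [|n IH]; first exact: commr0.
  by apply: commrD (commr1 _) (commrM (commr_refl _) IH).
have cv : c * v = v * c.
  apply: ucvg_unique (ucvgM (ucvg_cst c) sv) _ => /=.
  by under [X in ucvg X]funext do rewrite cs; exact: ucvgM sv (ucvg_cst c).
have vE : v = 1 + c * v.
  apply: ucvg_unique (ucvg_shift sv) _.
  by apply: ucvgD; [exact: ucvg_cst|apply: ucvgM => //; exact: ucvg_cst].
have v1 : (1 - c) * v = 1 by rewrite mulrBl mul1r {1}vE addrK.
by exists v; split => //; rewrite -[RHS]v1 mulrBl mulrBr mul1r mulr1 cv.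
Qed.

Lemma uinvertibleZ r u : r != 0 -> uinvertible u -> uinvertible (r%:C%C *: u).
Proof.
move=> r0 [v [uv vu]]; exists ((r^-1)%:C%C *: v).
by rewrite -!scalerAl -!scalerAr !scalerA uv vu -!rmorphM /= mulVf// mulfV//
  scale1r.
Qed.

Lemma uinvertible_ge0D g r : 0 < r -> uge0 g -> uinvertible (g + r%:C%C%:A).
Proof.
move=> r0 [_ [t tg]]; have t0 := ubnd_ge0 tg.
have tr0 : 0 < t + r by rewrite ltr_wpDl.
have -> : g + r%:C%C%:A =
    (t + r)%:C%C *: (1 - ((t + r)^-1)%:C%C *: (t%:C%C%:A - g)).
  rewrite scalerBr scalerA -rmorphM mulfV ?gt_eqF// scale1r rmorphD scalerDl.
  by rewrite opprB [RHS]addrC addrA subrK.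
apply: uinvertibleZ; first by rewrite gt_eqF.
apply: uinvertible_sub (ubndZ _ tg) _.
by rewrite cabs_real ger0_norm ?invr_ge0 ?ltW// mulrC ltr_pdivrMr// mul1r ltrDl.
Qed.

Lemma uinvertible_factor u w : uinvertible (u * w) -> u * w = w * u ->
  uinvertible u.
Proof.
move=> [v [uwv vuw]] uw; exists (w * v).
have vw : v * w = w * v.
  rewrite -[LHS]mulr1 -[X in _ * X = _]uwv -(mulrA u) mulrA -(mulrA v) -uw.
  by rewrite vuw mul1r.
by rewrite mulrA uwv -vw -mulrA -uw vuw.
Qed.

Lemma cone_cpositive x : cone x -> cpositive x.
Proof.
move=> x0; split=> [|[a b] lx]; first exact: cone_star.
apply: contrapT => l0; apply: lx.
suff [v [xv vx]] : uinvertible ((a +i* b)%C%:A - uinj x).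
  exists v; rewrite scalarE in xv vx.
  have E : (0, (a +i* b)%C) - uinj x = (- x, (a +i* b)%C) :> unitization A.
    by congr (_, _); rewrite ?sub0r ?subr0.
  by rewrite E in xv vx; split.
have [b0|b0] := eqVneq b 0.
  have a0 : 0 < - a.
    rewrite oppr_gt0 ltNge; apply/negP => a0; apply: l0.
    by rewrite lecE /= b0 eqxx.
  have N1 : -1 != 0 :> R by rewrite oppr_eq0 oner_eq0.
  have := uinvertibleZ N1 (uinvertible_ge0D a0 x0).
  rewrite rmorphN1 scaleN1r opprD addrC rmorphN /= scaleNr opprK b0.
  by [].
have [h hE] : exists h, h = a%:C%C%:A - uinj x by eexists.
have hs : ustar h = h.
  by rewrite hE ustarB ustarZ conjc_real ustar1 ustar_uinj cone_star.
have [z zE] : exists z : R[i], z = 'i%C * b%:C%C by eexists.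
have -> : (a +i* b)%C%:A - uinj x = h + z%:A.
  have -> : (a +i* b)%C = a%:C%C + z by rewrite zE [LHS]complexE.
  by rewrite hE scalerDl addrAC.
have zz : z * z = - (b ^+ 2)%:C%C.
  by rewrite zE mulrACA -[X in X * _]expr2 sqr_i mulN1r -rmorphM.
have uw : (h + z%:A) * (h - z%:A) = h * h + (b ^+ 2)%:C%C%:A.
  rewrite mulrDl !mulrBr mulr_algl mulr_algr addrA subrK mulr_algl scalerA.
  by rewrite zz scaleNr opprK.
apply: (@uinvertible_factor _ (h - z%:A)).
  rewrite uw; apply: uinvertible_ge0D; first by rewrite exprn_even_gt0.
  exact: uge0_sqr.
by apply: commrB; apply/commr_sym/commrD; rewrite // /GRing.comm
  ?mulr_algl ?mulr_algr.
Qed.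

End PositiveCone.
(** * Separation of the positive cone by functionals *)

Section HahnBanach.
Context {R : realType} {V : lmodType R[i]}.
Implicit Types (q p f : V -> R) (x y : V) (r s t : R).

Definition sublinear q : Prop :=
  (forall x y, q (x + y) <= q x + q y) /\
  forall r x, 0 <= r -> q (r%:C%C *: x) <= r * q x.

Definition real_linear f : Prop :=
  (forall x y, f (x + y) = f x + f y) /\ forall r x, f (r%:C%C *: x) = r * f x.

Lemma sublinearZ q r x : sublinear q -> 0 <= r -> q (r%:C%C *: x) = r * q x.
Proof.
move=> [qD qZ]; rewrite le_eqVlt => /predU1P[<-|r0].
  rewrite mul0r scale0r; apply/le_anti/andP; split.
    by have := qZ 0 0 (lexx _); rewrite scaler0 mul0r.
  by have := qD 0 0; rewrite addr0; lra.
apply/le_anti/andP; split; first exact: qZ (ltW r0).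
rewrite -ler_pdivlMl//.
have := qZ r^-1 (r%:C%C *: x); rewrite scalerA -rmorphM /= mulVf ?gt_eqF//.
by rewrite scale1r; apply; rewrite invr_ge0 ltW.
Qed.

Lemma sublinear_lb q x y : sublinear q -> q y - q (- x) <= q (x + y).
Proof.
move=> [qD _]; rewrite lerBlDr; apply: le_trans (qD _ _).
by rewrite addrAC subrr add0r.
Qed.

Lemma ge_inf_bound (E : set R) a b : lbound E b -> E a -> inf E <= a.
Proof. by move=> Eb; apply: ge_inf; exists b. Qed.

Definition directional q y x : R :=
  inf [set r | exists2 t, 0 <= t & r = q (x + t%:C%C *: y) - t * q y].

Lemma directional_lb q y x : sublinear q ->
  lbound [set r | exists2 t, 0 <= t & r = q (x + t%:C%C *: y) - t * q y]
    (- q (- x)).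
Proof.
move=> sq _ [t t0 ->]; rewrite -(sublinearZ _ sq t0).
by rewrite lerBrDl; exact: sublinear_lb.
Qed.

Lemma directional_le q y x t : sublinear q -> 0 <= t ->
  directional q y x <= q (x + t%:C%C *: y) - t * q y.
Proof.
by move=> sq t0; apply: ge_inf_bound; [exact: directional_lb sq|exists t].
Qed.

Lemma le_directional q y x b :
  (forall t, 0 <= t -> b <= q (x + t%:C%C *: y) - t * q y) ->
  b <= directional q y x.
Proof.
move=> xb; apply: lb_le_inf => [|_ [t t0 ->]]; last exact: xb.
by exists (q (x + 0%:C%C *: y) - 0 * q y), 0.
Qed.

Lemma sublinear_directional q y : sublinear q -> sublinear (directional q y).
Proof.
move=> sq; have [qD qZ] := sq; split=> [x z|r x].
  rewrite -lerBlDr; apply: le_directional => t t0.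
  rewrite lerBlDr -lerBlDl; apply: le_directional => s s0.
  rewrite lerBlDl.
  apply: le_trans (directional_le y (x + z) sq (addr_ge0 t0 s0)) _.
  rewrite rmorphD scalerDl [x + z + _]addrACA.
  by have := qD (x + t%:C%C *: y) (z + s%:C%C *: y); lra.
rewrite le_eqVlt => /predU1P[<-|r0].
  rewrite mul0r scale0r; apply: le_trans (directional_le y 0 sq (lexx 0)) _.
  by rewrite scale0r addr0 mul0r subr0 -(scale0r (0 : V)) (sublinearZ 0 sq) ?mul0r.
rewrite -ler_pdivrMl//; apply: le_directional => t t0.
rewrite ler_pdivrMl//.
have rt0 : 0 <= r * t by rewrite mulr_ge0// ltW.
apply: le_trans (directional_le y (r%:C%C *: x) sq rt0) _.
rewrite rmorphM -scalerA -scalerDr (sublinearZ _ sq (ltW r0)).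
by rewrite mulrBr mulrA.
Qed.

(* A minimal sublinear functional q is linear, since q = directional q y
   forces q (- y) = - q y. *)
Theorem hahn_banach p y : sublinear p ->
  exists f, [/\ real_linear f, forall x, f x <= p x & f (- y) <= - p y].
Proof.
move=> sp; pose p' := directional p y.
have sp' : sublinear p' := sublinear_directional y sp.
have p'p x : p' x <= p x.
  by have := directional_le y x sp (lexx 0); rewrite scale0r addr0 mul0r subr0.
have p'y : p' (- y) <= - p y.
  have := directional_le y (- y) sp ler01.
  rewrite rmorph1 scale1r addNr mul1r -(scale0r (0 : V)) (sublinearZ 0 sp)//.
  by rewrite mul0r sub0r.
pose T := {q : V -> R | sublinear q /\ forall x, q x <= p' x}.
pose le (q1 q2 : T) := `[< forall x, sval q2 x <= sval q1 x >].
have p'T : sublinear p' /\ forall x, p' x <= p' x by [].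
have [q minq] : exists q : T, premaximal le q.
  apply: (ZL_preorder (exist _ p' p'T : T)).
  - by move=> q; apply/asboolP.
  - move=> q1 q2 q3 /asboolP q12 /asboolP q23; apply/asboolP => x.
    exact: le_trans (q12 x).
  - move=> C totC; have [[q0 Cq0]|C0] := pselect (exists q : T, C q); last first.
      by exists (exist _ p' p'T : T) => s Cs; exfalso; apply: C0; exists s.
    pose E x := [set sval u x | u in C].
    have Elb x : lbound (E x) (- p' (- x)).
      move=> _ [q Cq <-]; have [sq qp] := svalP q.
      have := sublinear_lb (- x) 0 sq; rewrite addr0 opprK.
      have q00 : sval q 0 = 0.
        by rewrite -(scale0r (0 : V)) (sublinearZ 0 sq)// mul0r.
      by have := qp (- x); rewrite q00; lra.
    have Ele x (q : T) : C q -> inf (E x) <= sval q x.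
      by move=> Cq; apply: ge_inf_bound; [exact: Elb|exists q].
    have leE x b : (forall q : T, C q -> b <= sval q x) -> b <= inf (E x).
      move=> h; apply: lb_le_inf => [|_ [q Cq <-]]; last exact: h.
      by exists (sval q0 x), q0.
    have sE : sublinear (fun x => inf (E x)).
      split=> [x z|r x r0].
        rewrite -lerBlDr; apply/leE => q1 C1; rewrite lerBlDr -lerBlDl.
        apply/leE => q2 C2; rewrite lerBlDl.
        have [/asboolP le12|/asboolP le21] := totC _ _ C1 C2.
          apply: le_trans (Ele _ _ C2) _.
          by apply: le_trans ((svalP q2).1.1 _ _) _; rewrite lerD2r.
        apply: le_trans (Ele _ _ C1) _.
        by apply: le_trans ((svalP q1).1.1 _ _) _; rewrite lerD2l.
      move: r0; rewrite le_eqVlt => /predU1P[<-|r0].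
        rewrite mul0r scale0r; apply: le_trans (Ele _ _ Cq0) _.
        by rewrite -(scale0r (0 : V)) (sublinearZ 0 (svalP q0).1)// mul0r.
      rewrite -ler_pdivrMl//; apply/leE => q Cq; rewrite ler_pdivrMl//.
      apply: le_trans (Ele _ _ Cq) _.
      by apply: (svalP q).1.2; exact: ltW.
    have Ep' x : inf (E x) <= p' x.
      by apply: le_trans (Ele x _ Cq0) _; exact: (svalP q0).2.
    exists (exist _ (fun x => inf (E x)) (conj sE Ep') : T) => q Cq.
    apply/asboolP => x /=.
    exact: Ele.
have [sq qp'] := svalP q.
have qN z : sval q (- z) = - sval q z.
  pose q' := directional (sval q) z.
  have q'q x : q' x <= sval q x.
    by have := directional_le z x sq (lexx 0); rewrite scale0r addr0 mul0r subr0.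
  have q'T : sublinear q' /\ forall x, q' x <= p' x.
    split; first exact: sublinear_directional.
    by move=> x; exact: le_trans (qp' x).
  have /asboolP qq' : le (exist _ q' q'T : T) q.
    by apply: minq; apply/asboolP.
  have q0 : sval q 0 = 0.
    by rewrite -(scale0r (0 : V)) (sublinearZ 0 sq)// mul0r.
  apply/le_anti/andP; split.
    apply: le_trans (qq' _) _.
    have := directional_le z (- z) sq ler01.
    by rewrite rmorph1 scale1r addNr mul1r q0 sub0r.
  by have := sq.1 z (- z); rewrite subrr q0; lra.
exists (sval q); split.
- split=> [x z|r x].
    apply/le_anti; rewrite (svalP q).1.1/=.
    by have := sublinear_lb z x sq; rewrite qN opprK addrC [z + x]addrC addrC.
  have [r0|r0] := leP 0 r; first exact: sublinearZ.
  have := sublinearZ x sq (ltW (_ : 0 < - r)); rewrite oppr_gt0.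
  by move=> /(_ r0); rewrite rmorphN scaleNr qN mulNr => /oppr_inj.
- by move=> x; exact: le_trans (qp' x) (p'p x).
- exact: le_trans (qp' _) p'y.
Qed.

End HahnBanach.

Section Separation.
Context {R : realType} {A : cstarAlgType R}.
Implicit Types (x y c : A).

Let dist x : R := inf [set rnorm (x + c) | c in cone].

Let dist_lb x : lbound [set rnorm (x + c) | c in cone] 0.
Proof. by move=> _ [c _ <-]; exact: rnorm_ge0. Qed.

Let dist_le x c : cone c -> dist x <= rnorm (x + c).
Proof. by move=> c0; apply: ge_inf_bound; [exact: dist_lb|exists c]. Qed.

Lemma cone0 : cone (0 : A).
Proof. by have := cone_sqabs (0 : A); rewrite /sqabs cmulx0. Qed.

Let le_dist x b : (forall c, cone c -> b <= rnorm (x + c)) -> b <= dist x.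
Proof.
move=> h; apply: lb_le_inf => [|_ [c c0 <-]]; last exact: h.
by exists (rnorm (x + 0)), 0 => //; exact: cone0.
Qed.

Let sublinear_dist : sublinear dist.
Proof.
split=> [x y|r x].
  rewrite -lerBlDr; apply: le_dist => c c0; rewrite lerBlDr -lerBlDl.
  apply: le_dist => d d0; rewrite lerBlDl.
  apply: le_trans (dist_le _ (coneD c0 d0)) _.
  by rewrite addrACA rnormD.
rewrite le_eqVlt => /predU1P[<-|r0].
  rewrite mul0r scale0r; apply: le_trans (dist_le 0 cone0) _.
  by rewrite addr0 rnorm0.
rewrite -ler_pdivrMl//; apply: le_dist => c c0; rewrite ler_pdivrMl//.
apply: le_trans (dist_le _ (coneZ (ltW r0) c0)) _.
by rewrite -scalerDr rnormZ cabs_real gtr0_norm.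
Qed.

Lemma cone_dual y :
  (forall f : A -> R, real_linear f -> (forall x, `|f x| <= rnorm x) ->
    (forall c, cone c -> 0 <= f c) -> 0 <= f y) ->
  cone y.
Proof.
move=> yf; apply: cone_closed => e e0.
have [f [fl fd fy]] := hahn_banach (- y) sublinear_dist.
have f_le x : f x <= rnorm x.
  by apply: le_trans (fd x) _; have := dist_le x cone0; rewrite addr0.
have fN x : f (- x) = - f x.
  by have := fl.2 (-1) x; rewrite rmorphN1 scaleN1r mulN1r.
have f0 : 0 <= f y.
  apply: yf => //.
    by move=> x; rewrite ler_norml f_le andbT lerNl -fN -(rnormN x).
  move=> c c0; rewrite -oppr_le0 -fN; apply: le_trans (fd _) _.
  by apply: le_trans (dist_le _ c0) _; rewrite addNr rnorm0.
rewrite opprK in fy.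
have dy : dist (- y) < e by lra.
have [||_ [c c0 <-] ce] :=
  @inf_adherent _ [set rnorm (- y + c) | c in cone] (e - dist (- y)).
- by rewrite subr_gt0.
- by split; [exists (rnorm (- y + 0)), 0 => //; exact: cone0|exists 0].
exists c => //; rewrite -rnormN opprB addrC; move: ce; rewrite -/(dist _); lra.
Qed.

End Separation.
Section RealFunctionals.
Context {R : realType} {A : cstarAlgType R}.
Implicit Types (f : A -> R) (x y : A).

Definition bounded_functional f : Prop :=
  real_linear f /\ exists2 M, 0 <= M & forall x, `|f x| <= M * rnorm x.

Lemma real_linear0 f : real_linear f -> f 0 = 0.
Proof. by move=> [_ fZ]; have := fZ 0 0; rewrite scaler0 mul0r. Qed.

Lemma real_linearN f x : real_linear f -> f (- x) = - f x.
Proof. by move=> [_ fZ]; have := fZ (-1) x; rewrite rmorphN1 scaleN1r mulN1r. Qed.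

Lemma real_linearB f x y : real_linear f -> f (x - y) = f x - f y.
Proof. by move=> fl; rewrite fl.1 real_linearN. Qed.

Lemma bounded_functional_continuous f : bounded_functional f -> continuous f.
Proof.
move=> [fl [M M0 fM]] x; apply/cvgrPdist_le => e e0.
have eM : (0 : R[i]) < (e / (M + 1))%:C%C.
  by rewrite ltcR divr_gt0// ltr_wpDl.
near=> y; rewrite -real_linearB// (le_trans (fM _))//.
have : `|x - y| <= (e / (M + 1))%:C%C.
  by near: y; exact: (@cvgr_dist_le _ _ _ (nbhs x) _ id).
rewrite rnormE lecR ler_pdivlMr ?ltr_wpDl// => /(le_trans _); apply.
by rewrite mulrC ler_wpM2l ?rnorm_ge0// lerDl.
Unshelve. all: by end_near. Qed.

Definition complexify f x : R[i]^o := Complex (f x) (- f ('i%C *: x)).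

Lemma complexify_linear f : real_linear f -> linear (complexify f).
Proof.
move=> fl a x y; have fZ (b : R[i]) z :
    f (b *: z) = complex.Re b * f z + complex.Im b * f ('i%C *: z).
  rewrite [X in f (X *: _)]complexE scalerDl mulrC -scalerA fl.1.
  by rewrite !fl.2.
case: a => a b; apply/eqP; rewrite eq_complex /=; apply/andP; split; apply/eqP.
  by rewrite fl.1 fZ /=; ring.
rewrite scalerDr fl.1 scalerA fZ /=; ring.
Qed.

Lemma complexify_continuous f : bounded_functional f -> continuous (complexify f).
Proof.
move=> [fl [M M0 fM]] x; apply/cvgrPdist_le => _ /gt0_complexE[e e0 ->].
have M2 : 0 < M + M + 1 by rewrite ltr_wpDl// addr_ge0.
have eM : (0 : R[i]) < (e / (M + M + 1))%:C%C by rewrite ltcR divr_gt0.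
near=> y; have -> : complexify f x - complexify f y = complexify f (x - y).
  have := complexify_linear fl (-1) y x.
  by rewrite scaleN1r [_ *: _]mulN1r addrC [- _ + _]addrC.
have : `|x - y| <= (e / (M + M + 1))%:C%C.
  by near: y; exact: (@cvgr_dist_le _ _ _ (nbhs x) _ id).
rewrite rnormE lecR ler_pdivlMr// => xye.
rewrite cabsE lecR (le_trans (cabs_le _))//= normrN.
rewrite (le_trans (lerD (fM _) (fM _)))// rnormZ cabs_i mul1r.
rewrite -mulrDl (le_trans _ xye)// mulrC ler_wpM2l ?rnorm_ge0//.
by rewrite lerDl.
Unshelve. all: by end_near. Qed.

Lemma bounded_functional_mull f y : bounded_functional f ->
  bounded_functional (fun x => f (cmul y x)).
Proof.
move=> [fl [M M0 fM]]; split.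
  by split=> [x z|r x]; rewrite ?cmulDr ?fl.1// -cscalerAr fl.2.
exists (M * rnorm y); first by rewrite mulr_ge0// rnorm_ge0.
by move=> x; rewrite (le_trans (fM _))// -mulrA ler_wpM2l// rnormM.
Qed.

Lemma bounded_functional_mulr f y : bounded_functional f ->
  bounded_functional (fun x => f (cmul x y)).
Proof.
move=> [fl [M M0 fM]]; split.
  by split=> [x z|r x]; rewrite ?cmulDl ?fl.1// -cscalerAl fl.2.
exists (M * rnorm y); first by rewrite mulr_ge0// rnorm_ge0.
by move=> x; rewrite (le_trans (fM _))// -mulrA ler_wpM2l// mulrC rnormM.
Qed.

Lemma bounded_functional_star f : bounded_functional f ->
  bounded_functional (fun x => f (star x)).
Proof.
move=> [fl [M M0 fM]]; split.
  by split=> [x z|r x]; rewrite ?starD ?fl.1// starZ conjc_real fl.2.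
by exists M => // x; rewrite -(rnorm_star x).
Qed.

End RealFunctionals.

(** * Integration *)

Section Bochner.
Context {R : realType} {A : cstarAlgType R}.
Context {d : measure_display} {T : measurableType d}.
Variable mu : {measure set T -> \bar R}.
Implicit Types (f : A -> R) (F g : T -> A) (I : A).

Lemma simple_fun_measurable (s : T -> A) f : simple_fun s ->
  measurable_fun setT (f \o s).
Proof.
move=> [fs ms] _ B mB; rewrite setTI.
rewrite (_ : _ @^-1` B = \bigcup_(x in range s `&` (f @^-1` B)) s @^-1` [set x]).
  by apply: fin_bigcup_measurable => [|x _]; [exact: finite_setIl|exact: ms].
apply/seteqP; split => [t Bt|t [x [_ Bx] /= ->]//].
by exists (s t).
Qed.

Lemma strongly_measurable_functional g f : bounded_functional f ->
  strongly_measurable g -> measurable_fun setT (f \o g).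
Proof.
move=> fb [s ss sg]; apply: (@measurable_fun_cvg _ _ _ _ (fun n => f \o s n)) => [n|t _].
  exact: simple_fun_measurable.
exact: (cvg_comp _ _ (sg t) (bounded_functional_continuous fb (x := g t))).
Qed.

Lemma is_bochner_functional F I f : bounded_functional f -> is_bochner mu F I ->
  exists h : T -> R, [/\ {ae mu, forall t, f (F t) = h t},
    mu.-integrable setT (EFin \o h) & (f I)%:E = (\int[mu]_t (h t)%:E)%E].
Proof.
move=> fb [g [mg Fg ig gI]]; have [fl [M M0 fM]] := fb.
have ifg : mu.-integrable setT (EFin \o (f \o g)).
  apply: (@le_integrable _ _ _ _ _ measurableT _ (fun t => (M * rnorm (g t))%:E)).
  - by apply/measurable_EFinP; exact: strongly_measurable_functional.
  - move=> t _; rewrite /= lee_fin [leRHS]ger0_norm ?mulr_ge0 ?rnorm_ge0//.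
  - by under eq_fun do rewrite EFinM; exact: integrableZl.
exists (f \o g); split => //.
  by apply: filterS Fg => t ->.
pose phi : {linear A -> R[i]^o} :=
  HB.pack (complexify f) (GRing.isLinear.Build _ _ _ _ _ (complexify_linear fl)).
have := gI phi (complexify_continuous fb).
move=> /(congr1 (@complex.Re R)) /= ->.
by rewrite /Rintegral fineK//; exact: integrable_fin_num.
Qed.

Lemma ae_ge0_le_integrable (Q : T -> \bar R) (h : T -> R) :
  measurable_fun setT Q -> (forall t, 0 <= Q t)%E ->
  mu.-integrable setT (EFin \o h) -> {ae mu, forall t, (Q t <= (h t)%:E)%E} ->
  (\int[mu]_t Q t <= \int[mu]_t (h t)%:E)%E.
Proof.
move=> mQ Q0 ih Qh.
rewrite [leRHS](_ : _ = \int[mu]_t ((EFin \o h)^\+ t))%E.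
  apply: ae_ge0_le_integral => //.
    by have /integrable_funepos/measurable_int := ih; apply.
  apply: filterS Qh => t Qt _; rewrite funeposE le_max.
  by apply/orP; left.
have mh := measurable_int _ ih.
apply: ae_eq_integral => //; first exact: measurable_funepos.
apply: filterS Qh => t Qt _; rewrite funeposE /=; apply/esym/max_idPl.
exact: le_trans Qt.
Qed.

Lemma ae_integrable_le_ge0 (G : T -> \bar R) (k : T -> R) :
  measurable_fun setT G -> (forall t, 0 <= G t)%E ->
  mu.-integrable setT (EFin \o k) -> {ae mu, forall t, ((k t)%:E <= G t)%E} ->
  (\int[mu]_t (k t)%:E <= \int[mu]_t G t)%E.
Proof.
move=> mG G0 ik kG.
apply: (@le_trans _ _ (\int[mu]_t ((EFin \o k)^\+ t))%E).
  apply: le_integral => //; first exact: integrable_funepos.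
  by move=> t _; rewrite funeposE le_max lexx.
apply: ae_ge0_le_integral => //.
  by have /integrable_funepos/measurable_int := ik; apply.
by apply: filterS kG => t kt _; rewrite funeposE ge_max kt G0.
Qed.

End Bochner.
HB.instance Definition _ (T U : ptopologicalType) := Pointed.on (T * U)%type.

Lemma continuous_borel_measurable {R : realType} {T : ptopologicalType}
    (f : T -> R) : continuous f -> measurable_fun setT (f : borel T -> R).
Proof.
move=> /continuousP cf; apply: (measurability _ (RGenOInfty.measurableE R)).
move=> _ [_ [a ->]] <-; rewrite setTI; apply: sub_sigma_algebra.
by apply: cf; exact: interval_open.
Qed.

Lemma open_borel_measurable {T : ptopologicalType} (U : set T) :
  open U -> measurable (U : set (borel T)).
Proof. exact: sub_sigma_algebra. Qed.

Lemma compact_borel_measurable {T : ptopologicalType} (K : set T) :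
  hausdorff_space T -> compact K -> measurable (K : set (borel T)).
Proof.
move=> hT /(compact_closed hT) cK; rewrite -(setCK K); apply: measurableC.
by apply: open_borel_measurable; exact: closed_openC.
Qed.

Section ProductMeasurability.
Context {R : realType} {T : ptopologicalType}.
Hypothesis hausdorffT : hausdorff_space T.
Variable c : T * T -> R.
Hypothesis cc : continuous c.

(* By compactness [c >= s] is covered by finitely many open rectangles on which
   c > r. *)
Lemma compact_separation (K L : set T) (r s : R) : compact K -> compact L ->
  r < s -> exists M : set (borel T * borel T), [/\ measurable M,
    M `<=` [set p | r < c p] & K `*` L `&` [set p | s <= c p] `<=` M].
Proof.
move=> cK cL rs; pose C := K `*` L `&` [set p : T * T | s <= c p].
have cC : compact C.
  apply: compact_closedI; first exact: compact_setX.
  by have /continuous_closedP/(_ [set x | s <= x]) := cc; apply; exact: closed_ge.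
pose D := [set UV : set T * set T | [/\ open UV.1, open UV.2 &
  UV.1 `*` UV.2 `<=` [set p | r < c p]]].
move: cC; rewrite (@compact_cover (T * T)%type) => /(_ _ D (fun UV => UV.1 `*` UV.2)) [].
- move=> [U V] [/= oU oV _]; rewrite openE => -[x y] [/= Ux Vy].
  by exists (U, V) => //; split; exact: open_nbhs_nbhs.
- move=> [x y] [_ /= sxy].
  have : nbhs (x, y) (c @^-1` [set z | r < z]).
    by apply: cc; apply: open_nbhs_nbhs; split; [exact: open_gt|exact: lt_le_trans sxy].
  case=> -[U V] [/= xU yV] UVc.
  move: xU yV; rewrite !nbhsE => -[U' [oU' xU'] U'U] [V' [oV' yV'] V'V].
  exists (U', V') => //; split => //= p [pU pV]; apply: UVc; split => /=.
    exact: U'U.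
  exact: V'V.
move=> F FD FC; exists (\bigcup_(UV in [set` F]) (UV.1 `*` UV.2)); split.
- apply: fin_bigcup_measurable; first exact: finite_fset.
  move=> UV /FD/set_mem[oU oV _].
  by apply: measurableX; exact: open_borel_measurable.
- by move=> p [UV /FD/set_mem[_ _ UVc] pUV]; exact: UVc.
- by move=> p /FC[UV UVF pUV]; exists UV.
Qed.

Lemma sigma_compact_measurable_fun (K : nat -> set T) :
  (forall i, compact (K i)) ->
  measurable_fun ((\bigcup_i K i) `*` (\bigcup_i K i) : set (borel T * borel T))
    (c : borel T * borel T -> R).
Proof.
move=> cK mW; apply: (measurability _ (RGenOInfty.measurableE R)) => //.
move=> _ [_ [r ->]] <-.
pose P (i : nat * nat * nat) (M : set (borel T * borel T)) :=
  [/\ measurable M, M `<=` [set p | r < c p] &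
    K i.1.1 `*` K i.1.2 `&` [set p | r + i.2.+1%:R^-1 <= c p] `<=` M].
have [M MP] : {M & forall i, P i (M i)}.
  apply: choice => i; apply: compact_separation => //.
  by rewrite ltrDl invr_gt0.
rewrite (_ : _ `&` _ =
    (\bigcup_i K i) `*` (\bigcup_i K i) `&` \bigcup_i M i); last first.
  apply/seteqP; split => p [Wp]; last first.
    case=> i _; have [_ Mc _] := MP i => /Mc rp.
    by split => //=; rewrite in_itv/= andbT.
  rewrite /= in_itv/= andbT => rp; split => //.
  case: (Wp) => -[i _ Ki] [j _ Lj].
  have [n rn] : exists n : nat, r + n.+1%:R^-1 <= c p.
    have cr : 0 < c p - r by rewrite subr_gt0.
    have [n _ /(_ n (leqnn n))] := near_infty_natSinv_lt (PosNum cr).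
    by rewrite /= => /ltW; rewrite lerBrDl; exists n.
  by exists (i, j, n) => //; have [_ _] := MP (i, j, n); apply.
apply: measurableI => //; apply: countable_bigcupT_measurable => //.
by move=> i; case: (MP i).
Qed.

End ProductMeasurability.
Section SigmaFiniteMeasureOf.
Context {R : realType} {d : measure_display} {X : measurableType d}.
Variables (mu : {measure set X -> \bar R}) (sf : sigma_finite setT mu).

Definition sigma_finite_measure_of : {sigma_finite_measure set X -> \bar R} :=
  HB.pack (Measure.sort mu)
    (isSFinite.Build _ _ _ (Measure.sort mu) (sfinite_measure_sigma_finite sf))
    (isSigmaFinite.Build _ _ _ (Measure.sort mu) sf).

End SigmaFiniteMeasureOf.

Section TonelliOnCarrier.
Context {R : realType} {d : measure_display} {X : measurableType d}.
Variables (mu : {measure set X -> \bar R}) (W : set X) (K : nat -> set X).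
Hypotheses (mW : measurable W) (mK : forall i, measurable (K i)).
Hypotheses (WK : W = \bigcup_i K i) (finK : forall i, (mu (K i) < +oo)%E).

Lemma sigma_finite_mrestr : sigma_finite setT (mrestr mu mW).
Proof.
exists (fun n => if n is k.+1 then K k else ~` W).
  apply/seteqP; split=> // x _; have [|nWx] := pselect (W x).
    by rewrite WK => -[i _ Kx]; exists i.+1.
  by exists 0%N.
case=> [|k]; split; rewrite /mrestr ?setICl ?measure0//.
  exact: measurableC.
by rewrite setIidl// WK => x Kx; exists k.
Qed.

Lemma integral_mrestr (f : X -> \bar R) : (forall x, ~ W x -> f x = 0%E) ->
  (\int[mrestr mu mW]_x f x = \int[mu]_x f x)%E.
Proof.
move=> f0; have -> : f = f \_ W.
  by apply/funext => x; rewrite patchE; case: ifPn => // /negP xW;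
    apply: f0 => Wx; apply: xW; exact: mem_set.
rewrite -!integral_mkcond; apply: eq_measure_integral => B _ BW.
by rewrite /= /mrestr setIidl.
Qed.

Variable f : X * X -> \bar R.
Hypotheses (mf : measurable_fun setT f) (f0 : forall p, (0 <= f p)%E).
Hypothesis fW : forall p, ~ (W p.1 /\ W p.2) -> f p = 0%E.

Let m := sigma_finite_measure_of sigma_finite_mrestr.

Let integral_m (g : X -> \bar R) : (forall x, ~ W x -> g x = 0%E) ->
  (\int[m]_x g x = \int[mu]_x g x)%E.
Proof.
by move=> g0; rewrite -integral_mrestr//; exact: eq_measure_integral.
Qed.

Let integral_mx x : (\int[m]_y f (x, y) = \int[mu]_y f (x, y))%E.
Proof. by apply: integral_m => y Wy; apply: fW => -[]. Qed.

Let integral_my y : (\int[m]_x f (x, y) = \int[mu]_x f (x, y))%E.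
Proof. by apply: integral_m => x Wx; apply: fW => -[]. Qed.

Lemma measurable_integral_carrier :
  measurable_fun setT (fun x => \int[mu]_y f (x, y))%E.
Proof.
under eq_fun do rewrite -integral_mx.
exact: (@measurable_fun_fubini_tonelli_F _ _ _ _ _ m).
Qed.

Lemma tonelli_carrier : (\int[mu]_x \int[mu]_y f (x, y) =
  \int[mu]_y \int[mu]_x f (x, y))%E.
Proof.
rewrite -[LHS]integral_m; last first.
  by move=> x Wx; apply: integral0_eq => y _; apply: fW => -[].
rewrite -[RHS]integral_m; last first.
  by move=> y Wy; apply: integral0_eq => x _; apply: fW => -[].
under eq_integral do rewrite -integral_mx.
under [RHS]eq_integral do rewrite -integral_my.
exact: fubini_tonelli.
Qed.

End TonelliOnCarrier.

Section Carrier.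
Context {R : realType} {A : cstarAlgType R} {T : ptopologicalType}.
Variable mu : {measure set (borel T) -> \bar R}.
Hypotheses (hausdorffT : hausdorff_space T) (radon_mu : radon mu).

Lemma rnorm_continuous : continuous (@rnorm R A).
Proof.
move=> x; apply/cvgrPdist_le => e e0.
have e0' : (0 : R[i]) < e%:C%C by rewrite ltcR.
near=> y; have : `|x - y| <= e%:C%C.
  by near: y; exact: (@cvgr_dist_le _ _ _ (nbhs x) _ id).
rewrite rnormE lecR; apply: le_trans.
have := rnormD (x - y) y; have := rnormD (y - x) x.
rewrite !subrK -(rnormN (y - x)) opprB ler_norml; lra.
Unshelve. all: by end_near. Qed.

Lemma sigma_compact_carrier (D : T -> A) : continuous D ->
  norm_integrable mu D -> exists K : nat -> set T,
    (forall i, compact (K i)) /\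
    {ae mu, forall t : borel T, ~ (\bigcup_i K i) t -> D t = 0}.
Proof.
move=> cD iD.
have cnD : continuous (fun t => rnorm (D t)).
  by move=> t; apply: (continuous_comp (cD t)); exact: rnorm_continuous.
have mrD : measurable_fun setT (fun t : borel T => rnorm (D t)).
  exact: continuous_borel_measurable.
pose S (n : nat) := [set t | n.+1%:R^-1 < rnorm (D t)].
have oS n : open (S n).
  by have /continuousP/(_ [set x | n.+1%:R^-1 < x]) := cnD; apply; exact: open_gt.
have mS n : measurable (S n : set (borel T)) by exact: open_borel_measurable.
have finS n : (mu (S n) < +oo)%E.
  have n0 : 0 < n.+1%:R^-1 :> R by rewrite invr_gt0.
  rewrite ltNge leye_eq; apply/negP => /eqP Soo.
  suff : ((n.+1%:R^-1)%:E * mu (S n) < +oo)%E by rewrite Soo gt0_muley ?lte_fin.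
  rewrite -integral_cst//.
  apply: (@le_lt_trans _ _ (\int[mu]_t (rnorm (D t))%:E)%E).
    apply: (@le_trans _ _ (\int[mu]_(t in S n) (rnorm (D t))%:E)%E).
      apply: ge0_le_integral => //.
      - by move=> t _; rewrite lee_fin ltW.
      - by apply/measurable_EFinP; exact: measurable_funTS.
      - by move=> t /= /ltW; rewrite lee_fin.
    apply: ge0_subset_integral => //.
      exact/measurable_EFinP.
    by move=> t _; rewrite lee_fin rnorm_ge0.
  have /integrableP[_] := iD.
  by under eq_integral do rewrite /= ger0_norm ?rnorm_ge0//.
have [finK _ innerS] := radon_mu.
pose P (i : nat * nat) (L : set T) :=
  [/\ compact L, L `<=` S i.1 & (mu (S i.1) - (i.2.+1%:R^-1)%:E < mu L)%E].
have [L LP] : {L & forall i, P i (L i)}.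
  apply: choice => -[n k] /=; have := innerS _ (oS n).
  have k0 : 0 < k.+1%:R^-1 :> R by rewrite invr_gt0.
  move=> muS; have : ereal_sup [set mu K | K in [set K | compact K /\ K `<=` S n]]
     \is a fin_num by rewrite -muS ge0_fin_numE.
  by move=> /(ub_ereal_sup_adherent k0)[_ [M [cM MS] <-]]; rewrite -muS; exists M.
exists (fun k => L (odflt (0, 0)%N (choice.unpickle k))); split.
  by move=> k; case: (LP (odflt (0, 0)%N (choice.unpickle k))).
set W := \bigcup_k _.
have LW i : L i `<=` W.
  by move=> t Lt; exists (choice.pickle i) => //=; rewrite choice.pickleK.
have mW : measurable (W : set (borel T)).
  apply: bigcupT_measurable => k; apply: compact_borel_measurable => //.
  by case: (LP (odflt (0, 0)%N (choice.unpickle k))).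
have SW n : mu (S n `\` W) = 0%E.
  apply/eqP; rewrite eq_le measure_ge0 andbT; apply/lee_addgt0Pr => e e0.
  rewrite add0e.
  have [k _ /(_ k (leqnn k)) /= ke] := near_infty_natSinv_lt (PosNum e0).
  have [cL LS muL] := LP (n, k).
  have mL : measurable (L (n, k) : set (borel T)) by exact: compact_borel_measurable.
  apply: (@le_trans _ _ (mu (S n `\` L (n, k)))).
    have mSW : measurable (S n `\` W : set (borel T)) by exact: measurableD.
    have mSL : measurable (S n `\` L (n, k) : set (borel T)) by exact: measurableD.
    apply: le_measure; [exact: mem_set|exact: mem_set|].
    by move=> t [St nWt]; split => // Lt; exact: nWt (LW _ _ Lt).
  rewrite (measureD (mS n) mL (finS n)) (setIidr LS).
  apply: (@le_trans _ _ (k.+1%:R^-1)%:E); last by rewrite lee_fin ltW.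
  have fL : mu (L (n, k)) \is a fin_num by rewrite ge0_fin_numE// finK.
  have fS : mu (S n) \is a fin_num by rewrite ge0_fin_numE.
  move: muL; rewrite /= -(fineK fL) -(fineK fS) -!EFinB lte_fin lee_fin.
  by rewrite lerBlDr -lerBlDl => /ltW.
have [N [mN N0 SN]] : mu.-negligible (\bigcup_n (S n `\` W)).
  apply: negligible_bigcup => n; apply/negligibleP; last exact: SW.
  exact: measurableD.
exists N; split => //; apply: subset_trans SN.
move=> t /= /not_implyP[nWt Dt].
have rD : 0 < rnorm (D t).
  by rewrite lt_def rnorm_ge0 andbT; apply/eqP => /rnorm_eq0.
have [n _ /(_ n (leqnn n)) /= nD] := near_infty_natSinv_lt (PosNum rD).
by exists n.
Qed.

End Carrier.
(** * The double integral *)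

Section Continuity.
Context {R : realType} {A : cstarAlgType R} {X : topologicalType}.
Implicit Types u v : X -> A.

Lemma continuous_star u : continuous u -> continuous (fun x => star (u x)).
Proof.
move=> cu x; apply/cvgrPdist_le => _ /gt0_complexE[e e0 ->].
have e0' : (0 : R[i]) < e%:C%C by rewrite ltcR.
near=> y; have : `|u x - u y| <= e%:C%C.
  by near: y; apply: cvgr_dist_le (cu x) _ e0'.
by rewrite !rnormE !lecR -starN -starD rnorm_star.
Unshelve. all: by end_near. Qed.

Lemma continuous_cmul u v : continuous u -> continuous v ->
  continuous (fun x => cmul (u x) (v x)).
Proof.
move=> cu cv x; apply/cvgrPdist_le => _ /gt0_complexE[e e0 ->].
have u0 := rnorm_ge0 (u x); have v0 := rnorm_ge0 (v x).
pose e1 := e / 2 / (rnorm (u x) + 1).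
have e1_gt0 : 0 < e1 by rewrite !divr_gt0// ltr_wpDl.
pose e2 := e / 2 / (rnorm (v x) + e1 + 1).
have e2_gt0 : 0 < e2 by rewrite !divr_gt0// ltr_wpDl// addr_ge0// ltW.
have e1c : (0 : R[i]) < e1%:C%C by rewrite ltcR.
have e2c : (0 : R[i]) < e2%:C%C by rewrite ltcR.
near=> y.
have : `|u x - u y| <= e2%:C%C.
  by near: y; apply: cvgr_dist_le (cu x) _ e2c.
have : `|v x - v y| <= e1%:C%C.
  by near: y; apply: cvgr_dist_le (cv x) _ e1c.
rewrite !rnormE !lecR => vxy uxy.
have -> : cmul (u x) (v x) - cmul (u y) (v y) =
    cmul (u x) (v x - v y) + cmul (u x - u y) (v y).
  by rewrite cmulDl cmulDr cmulNx cmulxN addrA subrK.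
have vy : rnorm (v y) <= rnorm (v x) + e1.
  have := rnormB (v x) (v x - v y); rewrite opprB addrC subrK.
  by move/le_trans; apply; rewrite lerD2l.
rewrite (le_trans (rnormD _ _))// (splitr e) lerD// (le_trans (rnormM _ _))//.
  rewrite (le_trans (ler_wpM2l u0 vxy))// /e1 mulrCA ger_pMr ?divr_gt0//.
  by rewrite ler_pdivrMr ?ltr_wpDl// mul1r lerDl.
have ve : 0 <= rnorm (v x) + e1 by rewrite addr_ge0// ltW.
apply: (le_trans (ler_pM (rnorm_ge0 _) (rnorm_ge0 _) uxy vy)).
rewrite /e2 mulrAC ler_pdivrMr ?ltr_wpDl// ler_wpM2l ?lerDl//.
by rewrite ltW// divr_gt0.
Unshelve. all: by end_near. Qed.

Lemma continuous_functional (f : A -> R) u : bounded_functional f ->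
  continuous u -> continuous (fun x => f (u x)).
Proof.
by move=> fb cu x; apply: (continuous_comp (cu x)); exact: bounded_functional_continuous.
Qed.

End Continuity.

Lemma cabs_continuous {R : realType} : continuous (@cabs R : R[i]^o -> R).
Proof.
move=> a; apply/(@cvgrPdist_le _ _ _ _ (nbhs_filter (a : R[i]^o))) => e e0.
have e0' : (0 : R[i]) < e%:C%C by rewrite ltcR.
near=> b; have : `|a - b| <= e%:C%C.
  near: b; apply: (@cvgr_dist_le _ R[i]^o R[i]^o (nbhs (a : R[i]^o)) _ id a) => //.
rewrite cabsE lecR; apply: le_trans.
have := cabsD (a - b) b; have := cabsD (b - a) a.
rewrite !subrK -(cabsN (b - a)) opprB ler_norml; lra.
Unshelve. all: by end_near. Qed.

Lemma sqabs_expand {R : realType} {A : cstarAlgType R} (a b : R[i]) (x y : A) :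
  conjc a * b = 1 -> sqabs (a *: x - b *: y) =
  (cabs a ^+ 2)%:C%C *: sqabs x + (cabs b ^+ 2)%:C%C *: sqabs y -
  (cmul (star x) y + cmul (star y) x).
Proof.
move=> ab; have ba : conjc b * a = 1.
  by have := congr1 (@conjc R) ab; rewrite rmorph1 rmorphM /= conjcK mulrC.
have cc z : conjc z * z = (cabs z ^+ 2)%:C%C.
  by rewrite mulrC -sqr_normc cabsE -rmorphXn.
rewrite /sqabs starD starN !starZ cmulDl !cmulDr !cmulNx !cmulxN.
rewrite -!cscalerAl -!cscalerAr !scalerA ab ba !cc !scale1r opprK opprD.
by rewrite addrA [LHS](ACl (1*4*2*3)) /= addrA.
Qed.

Section RealFunctionalsSum.
Context {R : realType} {A : cstarAlgType R}.

Lemma bounded_functionalD (f g : A -> R) : bounded_functional f ->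
  bounded_functional g -> bounded_functional (fun x => f x + g x).
Proof.
move=> [fl [M M0 fM]] [gl [N N0 gN]]; split.
  split=> [x y|r x]; first by rewrite fl.1 gl.1 addrACA.
  by rewrite fl.2 gl.2 mulrDr.
exists (M + N); first exact: addr_ge0.
by move=> x; rewrite (le_trans (ler_normD _ _))// mulrDl lerD.
Qed.

Lemma bounded_functional_pairing (f : A -> R) (y : A) : bounded_functional f ->
  bounded_functional (fun x => f (cmul (star y) x) + f (cmul (star x) y)).
Proof.
move=> fb; apply: bounded_functionalD; first exact: bounded_functional_mull.
exact: (bounded_functional_star (bounded_functional_mulr y fb)).
Qed.

End RealFunctionalsSum.
Section DoubleIntegral.
Context {R : realType} {Alg : cstarAlgType R} {T : ptopologicalType}.
Variable mu : {measure set (borel T) -> \bar R}.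
Variables (A B : T -> Alg) (alpha : T -> T -> R[i]).
Hypotheses (hausdorffT : hausdorff_space T) (radon_mu : radon mu).
Hypotheses (contA : continuous A) (contB : continuous B).
Hypotheses (intA : norm_integrable mu A) (intB : norm_integrable mu B).
Hypothesis malpha : measurable_fun [set: borel T * borel T]
  ((fun p => alpha p.1 p.2) : borel T * borel T -> borel R[i]^o).
Hypothesis halpha : forall t s : T, conjc (alpha t s) * alpha s t = 1.

Let F t s : Alg := sqabs (alpha t s *: A t - alpha s t *: B s).
Let D t : Alg := A t - B t.

Variable f : Alg -> R.
Hypotheses (fb : bounded_functional f) (f_ge0 : forall x, cone x -> 0 <= f x).

Let g (p : T * T) : R := f (F p.1 p.2).

Let g_ge0 p : 0 <= g p.
Proof. exact/f_ge0/cone_sqabs. Qed.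

Let omega (p : borel T * borel T) : R := cabs (alpha p.1 p.2) ^+ 2.

Let measurable_omega : measurable_fun setT omega.
Proof.
apply: measurable_funX.
exact: (measurableT_comp (continuous_borel_measurable (@cabs_continuous R)) malpha).
Qed.

Let cross (p : T * T) : R :=
  f (cmul (star (A p.1)) (B p.2) + cmul (star (B p.2)) (A p.1)).

Let continuous_cross : continuous cross.
Proof.
have cA : continuous (fun p : T * T => A p.1).
  by move=> p; apply: continuous_comp; [exact: cvg_fst|exact: contA].
have cB : continuous (fun p : T * T => B p.2).
  by move=> p; apply: continuous_comp; [exact: cvg_snd|exact: contB].
apply: continuous_functional => // p.
have h1 := continuous_cmul (continuous_star cA) cB (x := p).
have h2 := continuous_cmul (continuous_star cB) cA (x := p).
exact: (cvgD h1 h2).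
Qed.

Let gE p : g p = omega p * f (sqabs (A p.1)) + omega (p.2, p.1) * f (sqabs (B p.2)) -
  cross p.
Proof.
have fl := fb.1; rewrite /g /F sqabs_expand// real_linearB// fl.1 !fl.2.
by [].
Qed.

Let measurable_sqabs (u : T -> Alg) : continuous u ->
  measurable_fun setT ((fun t => f (sqabs (u t))) : borel T -> R).
Proof.
move=> cu; apply: (@continuous_borel_measurable R T (fun t => f (sqabs (u t)))).
apply: (continuous_functional fb).
exact: (continuous_cmul (continuous_star cu) cu).
Qed.

Let mfst : measurable_fun setT (fun p : borel T * borel T => f (sqabs (A p.1))).
Proof. exact: (measurableT_comp (measurable_sqabs contA) measurable_fst). Qed.

Let msnd : measurable_fun setT (fun p : borel T * borel T => f (sqabs (B p.2))).
Proof. exact: (measurableT_comp (measurable_sqabs contB) measurable_snd). Qed.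

Let mswap : measurable_fun setT (fun p : borel T * borel T => omega (p.2, p.1)).
Proof. exact: (measurableT_comp measurable_omega (@measurable_swap _ _ _ _)). Qed.

Let measurable_g (W : set (borel T * borel T)) :
  measurable_fun W (cross : borel T * borel T -> R) ->
  measurable_fun W (g : borel T * borel T -> R).
Proof.
move=> mc; apply: (eq_measurable_fun (fun p : borel T * borel T =>
  omega p * f (sqabs (A p.1)) + omega (p.2, p.1) * f (sqabs (B p.2)) - cross p)).
  by move=> p _; rewrite gE.
apply: measurable_funB => //; apply: measurable_funTS.
by apply: measurable_funD; apply: measurable_funM.
Qed.

Let measurable_g_section s : measurable_fun setT ((fun t => g (t, s)) : borel T -> R).
Proof.
rewrite (_ : (fun t => _) = (fun t : borel T => omega (t, s) * f (sqabs (A t)) +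
  omega (s, t) * f (sqabs (B s)) - cross (t, s))); last first.
  by apply/funext => t; rewrite gE.
have pairl : measurable_fun setT (fun t : borel T => (t, s) : borel T * borel T).
  exact: pair2_measurable.
have pairr : measurable_fun setT (fun t : borel T => (s, t) : borel T * borel T).
  exact: pair1_measurable.
apply: measurable_funB; last first.
  apply: (@continuous_borel_measurable R T (fun t => cross (t, s))) => t.
  have ct : {for t, continuous (fun t : T => (t, s))}.
    by apply: cvg_pair => //; exact: cvg_cst.
  exact: (continuous_comp ct (continuous_cross (x := (t, s)))).
apply: measurable_funD; apply: measurable_funM => //.
- exact: (measurableT_comp measurable_omega pairl).
- exact: measurable_sqabs.
- exact: (measurableT_comp measurable_omega pairr).
Qed.

(* The difference of the two sides is the value of f at
   |alpha(t,s) A_t - alpha(s,t) A_s|^2 + |alpha(t,s) B_t - alpha(s,t) B_s|^2. *)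
Let symmetrized_ge t s :
  f (cmul (star (D s)) (D t)) + f (cmul (star (D t)) (D s)) <= g (t, s) + g (s, t).
Proof.
have fl := fb.1; rewrite !gE /cross /omega /=.
have := f_ge0 (cone_sqabs (alpha t s *: A t - alpha s t *: A s)).
have := f_ge0 (cone_sqabs (alpha t s *: B t - alpha s t *: B s)).
rewrite !sqabs_expand// !real_linearB// !fl.1 !fl.2.
rewrite /D !starD !starN !cmulDl !cmulDr !cmulNx !cmulxN.
have fD (x y : Alg) : f (x + y) = f x + f y by exact: fl.1.
have fN (x : Alg) : f (- x) = - f x by exact: real_linearN.
rewrite !fD !fN.
lra.
Qed.

Let J s : Alg := bochner mu (fun t => F t s).

Hypothesis int_inner : {ae mu, forall s : borel T,
  bochner_integrable mu (fun t => F t s)}.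
Hypothesis int_outer : bochner_integrable mu J.

Let bochnerP (h : T -> Alg) : bochner_integrable mu h ->
  is_bochner mu h (bochner mu h).
Proof. exact: xgetPex. Qed.

Let functional_inner s : bochner_integrable mu (fun t => F t s) ->
  (f (J s))%:E = (\int[mu]_t (g (t, s))%:E)%E.
Proof.
move=> /bochnerP/(is_bochner_functional fb)[h [gh ih ->]].
apply: ae_eq_integral => //; first exact: measurable_int ih.
  by apply/measurable_EFinP; exact: measurable_g_section.
by apply: filterS gh => t gt _; rewrite /= -gt.
Qed.

Let functional_outer : exists h : borel T -> R,
  [/\ {ae mu, forall s, (h s)%:E = (\int[mu]_t (g (t, s))%:E)%E},
    mu.-integrable setT (EFin \o h) &
    (f (bochner mu J))%:E = (\int[mu]_s (h s)%:E)%E].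
Proof.
have [h [Jh ih fZ]] := is_bochner_functional fb (bochnerP int_outer).
exists h; split => //; apply: filterS2 int_inner Jh => s /functional_inner.
by move=> <- ->.
Qed.

Lemma functional_double_ge0 : 0 <= f (bochner mu J).
Proof.
have [h [hg ih fZ]] := functional_outer.
rewrite -lee_fin fZ; apply: (@le_trans _ _ (\int[mu]_s cst 0%E s)%E).
  by rewrite integral0.
apply: ae_ge0_le_integrable => //.
by apply: filterS hg => s ->; apply: integral_ge0 => t _; rewrite lee_fin.
Qed.

Lemma functional_sqabs_le I : is_bochner mu D I ->
  f (sqabs I) <= f (bochner mu J).
Proof.
move=> DI; have [h [hg ih fZ]] := functional_outer.
have contD : continuous D by move=> t; apply: cvgB; [exact: contA|exact: contB].
have mD : measurable_fun setT ((fun t => rnorm (D t)) : borel T -> R).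
  apply: continuous_borel_measurable => t.
  exact: (continuous_comp (contD t) (rnorm_continuous (x := D t))).
have intD : norm_integrable mu D.
  rewrite /norm_integrable; apply: (@le_integrable _ _ _ _ _ measurableT _
    (fun t : borel T => (rnorm (A t))%:E + (rnorm (B t))%:E)%E).
  - exact/measurable_EFinP.
  - move=> t _; rewrite /= lee_fin !ger0_norm ?addr_ge0 ?rnorm_ge0//.
    exact: rnormB.
  - exact: integrableD.
have [K [cK D0]] := sigma_compact_carrier hausdorffT radon_mu contD intD.
pose W := \bigcup_i K i.
have mK i : measurable (K i : set (borel T)) by exact: compact_borel_measurable.
have finK i : (mu (K i) < +oo)%E by have [finK _ _] := radon_mu; exact: finK.
have mW : measurable (W : set (borel T)) by exact: bigcupT_measurable.
have mWW : measurable (W `*` W : set (borel T * borel T)) by exact: measurableX.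
pose Phi (p : borel T * borel T) : \bar R :=
  ((g : borel T * borel T -> R) \_ (W `*` W) p)%:E.
have mgW : measurable_fun (W `*` W : set (borel T * borel T))
    (g : borel T * borel T -> R).
  by apply: measurable_g; exact: sigma_compact_measurable_fun.
have mPhi : measurable_fun setT Phi.
  by apply/measurable_EFinP; exact: (measurable_restrictT _ mWW).1 mgW.
have Phi0 p : (0 <= Phi p)%E by rewrite lee_fin patchE; case: ifP.
have PhiW p : ~ (W p.1 /\ W p.2) -> Phi p = 0%E.
  by move=> nW; rewrite /Phi patchE; case: ifPn => // /set_mem.
have Phig p : (Phi p <= (g p)%:E)%E by rewrite lee_fin patchE; case: ifP.
have PhiE p : W p.1 -> W p.2 -> Phi p = (g p)%:E.
  by move=> W1 W2; rewrite /Phi patchE mem_set.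
pose Phis (p : borel T * borel T) := Phi (p.2, p.1).
have mPhis : measurable_fun setT Phis.
  exact: (measurableT_comp mPhi (@measurable_swap _ _ _ _)).
have Phis0 p : (0 <= Phis p)%E by exact: Phi0.
have PhisW p : ~ (W p.1 /\ W p.2) -> Phis p = 0%E.
  by move=> nW; apply: PhiW => /= -[? ?]; apply: nW.
pose Q s := (\int[mu]_t Phis (s, t))%E.
pose Q' s := (\int[mu]_t Phi (s, t))%E.
have mQ : measurable_fun setT Q by apply: (measurable_integral_carrier mW mK erefl finK).
have mQ' : measurable_fun setT Q' by apply: (measurable_integral_carrier mW mK erefl finK).
have QQ' : (\int[mu]_s Q s = \int[mu]_s Q' s)%E.
  exact: (tonelli_carrier mW mK erefl finK mPhis _ PhisW).
have Q0 s : (0 <= Q s)%E by exact: integral_ge0.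
have Q'0 s : (0 <= Q' s)%E by exact: integral_ge0.
have pair1s s : measurable_fun setT (fun t : borel T => (s, t) : borel T * borel T).
  exact: pair1_measurable.
have mPhi1 s : measurable_fun setT (fun t => Phi (s, t)).
  exact: (measurableT_comp mPhi (pair1s s)).
have mPhis1 s : measurable_fun setT (fun t => Phis (s, t)).
  exact: (measurableT_comp mPhis (pair1s s)).
have QfZ : (\int[mu]_s Q s <= (f (bochner mu J))%:E)%E.
  rewrite fZ; apply: (ae_ge0_le_integrable mQ Q0 ih).
  apply: filterS hg => s ->; apply: ge0_le_integral.
  - exact: measurableT.
  - by move=> t _; exact: Phis0.
  - exact: mPhis1.
  - by apply/measurable_EFinP; exact: measurable_g_section.
  - by move=> t _; exact: Phig.
have QQ'E s : (Q s + Q' s = \int[mu]_t (Phis (s, t) + Phi (s, t)))%E.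
  by rewrite ge0_integralD.
have f0 : f 0 = 0 by exact: real_linear0 fb.1.
have kQ : {ae mu, forall s : borel T,
    ((f (cmul (star I) (D s)) + f (cmul (star (D s)) I))%:E <= Q s + Q' s)%E}.
  apply: filterS (D0) => s Ds0.
  have [Ws|/Ds0 ->] := pselect (W s); last first.
    by rewrite cmulx0 star0 cmul0x f0 addr0 adde_ge0.
  rewrite addrC QQ'E.
  have [k [Dk ik /= ->]] :=
    is_bochner_functional (bounded_functional_pairing (D s) fb) DI.
  apply: ae_integrable_le_ge0 ik _.
  - exact: emeasurable_funD.
  - by move=> t; rewrite adde_ge0.
  apply: filterS2 Dk D0 => t <- Dt0.
  have [Wt|/Dt0 ->] := pselect (W t); last first.
    by rewrite cmulx0 star0 cmul0x f0 addr0 adde_ge0.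
  by rewrite /Phis !PhiE// -EFinD lee_fin; exact: symmetrized_ge.
have [k [Dk ik /= fI]] := is_bochner_functional (bounded_functional_pairing I fb) DI.
have le2 : ((f (sqabs I) + f (sqabs I))%:E <=
    (f (bochner mu J) + f (bochner mu J))%:E)%E.
  rewrite [leLHS]fI EFinD.
  apply: (@le_trans _ _ (\int[mu]_s (Q s + Q' s))%E).
    apply: ae_integrable_le_ge0 ik _.
    - exact: emeasurable_funD.
    - by move=> s; rewrite adde_ge0.
    by apply: filterS2 Dk kQ => s <-.
  by rewrite ge0_integralD// -QQ' leeD.
by move: le2; rewrite lee_fin; lra.
Qed.

End DoubleIntegral.
Theorem corollary2p6 (R : realType) (Alg : cstarAlgType R)
    (T : ptopologicalType) (mu : {measure set (borel T) -> \bar R})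
    (A B : T -> Alg) (alpha : T -> T -> R[i])
    (hausdorffT : hausdorff_space T)
    (lcompactT : locally_compact [set: T])
    (radon_mu : radon mu)
    (contA : continuous A) (contB : continuous B)
    (intA : norm_integrable mu A) (intB : norm_integrable mu B)
    (malpha : measurable_fun [set: borel T * borel T]
       ((fun p => alpha p.1 p.2) : borel T * borel T -> borel R[i]^o))
    (halpha : forall t s : T, conjc (alpha t s) * alpha s t = 1)
    (int_inner : {ae mu, forall s : borel T, bochner_integrable mu
       (fun t => sqabs (alpha t s *: A t - alpha s t *: B s))})
    (int_outer : bochner_integrable mu (fun s => bochner mu
       (fun t => sqabs (alpha t s *: A t - alpha s t *: B s)))) :
  cle (sqabs (bochner mu (fun t => A t - B t)))
      (bochner mu (fun s => bochner mu
         (fun t => sqabs (alpha t s *: A t - alpha s t *: B s)))).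
Proof.
apply/cone_cpositive/cone_dual => f fl fM f_ge0.
have fb : bounded_functional f by split=> //; exists 1 => // x; rewrite mul1r.
rewrite real_linearB// subr_ge0.
have [iD|nD] := pselect (bochner_integrable mu (fun t => A t - B t)).
  apply: (functional_sqabs_le hausdorffT radon_mu contA contB) => //.
  exact: xgetPex.
rewrite [bochner mu (fun t => A t - B t)]xgetPN; last first.
  by move=> I DI; apply: nD; exists I.
rewrite /sqabs cmulx0 real_linear0//.
exact: (functional_double_ge0 contA contB malpha halpha).
Qed.
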